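(* Let $\boldsymbol\mu=\{\mu_\beta\}_{|\beta|\ge1}$ be a weight sequence such that $\mathcal D(\boldsymbol\mu)$ contains a neighborhood of the origin. Then the algebra $F_s^\infty(\boldsymbol\mu)$ is reflexive.
   Context: $\mathbb F_n^+$ is the unital free semigroup on generators $g_1,\ldots,g_n$ with identity $g_0$. $F^2(H_n)$ is the full Fock space, a Hilbert space with orthonormal basis $\{e_\alpha\}_{\alpha\in\mathbb F_n^+}$. For $\alpha=g_{i_1}\cdots g_{i_k}$: $\lambda_\alpha:=\lambda_{i_1}\cdots\lambda_{i_k}$, $\boldsymbol\mu(\alpha,g_0):=\mu_{g_{i_1}\cdots g_{i_k}}\mu_{g_{i_2}\cdots g_{i_k}}\cdots\mu_{g_{i_k}}$; for $g_0$ both are $1$. Standing assumptions: $\mu_\beta>0$, and for each $i$, $\sup_\alpha\mu_{g_i\alpha}<\infty$ and $\sup_\alpha\boldsymbol\mu(\alpha g_i,g_0)/\boldsymbol\mu(\alpha,g_0)<\infty$. The weighted left multi-shift is $W_ie_\alpha:=\mu_{g_i\alpha}e_{g_i\alpha}$. $\mathcal D(\boldsymbol\mu):=\{\lambda\in\mathbb C^n:\sum_\alpha|\lambda_\alpha|^2/\boldsymbol\mu(\alpha,g_0)^2<\infty\}$. For $\mathbf k\in\mathbb N_0^n$, $\lambda^{\mathbf k}:=\lambda_1^{k_1}\cdots\lambda_n^{k_n}$, $\Lambda_{\mathbf k}:=\{\alpha:\lambda_\alpha=\lambda^{\mathbf k}\ \forall\lambda\in\mathbb C^n\}$, $\omega_{\mathbf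 k}:=\sum_{\alpha\in\Lambda_{\mathbf k}}\boldsymbol\mu(\alpha,g_0)^{-2}$, $y^{(\mathbf k)}:=\frac1{\omega_{\mathbf k}}\sum_{\alpha\in\Lambda_{\mathbf k}}\frac1{\boldsymbol\mu(\alpha,g_0)}e_\alpha$. $F_s^2(\boldsymbol\mu)$ is the closed span of the $y^{(\mathbf k)}$; $B_i:=P_{F_s^2(\boldsymbol\mu)}W_i|_{F_s^2(\boldsymbol\mu)}$. $F_s^\infty(\boldsymbol\mu)\subset B(F_s^2(\boldsymbol\mu))$ is the $w^*$-closed non-self-adjoint algebra generated by $B_1,\ldots,B_n$ and the identity. For $\mathcal U\subset B(\mathcal H)$, $\mathrm{Lat}\,\mathcal U$ is the set of closed subspaces invariant under every $A\in\mathcal U$; for a collection $\mathcal S$ of subspaces, $\mathrm{Alg}\,\mathcal S:=\{A\in B(\mathcal H):\mathcal S\subset\mathrm{Lat}\,A\}$. An algebra $\mathcal U$ is reflexive if $\mathcal U=\mathrm{Alg}\,\mathrm{Lat}\,\mathcal U$. *)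

(* Defs.v *)
Set Warnings "-notation-overridden,-ambiguous-paths".
Set Warnings "-notation-incompatible-prefix,-redundant-canonical-projection".
Set Warnings "-projection-no-head-constant".
From HB Require Import structures.
From mathcomp Require Import all_boot all_order all_algebra.
From mathcomp Require Import finmap complex.
From mathcomp Require Import all_classical all_reals.
From mathcomp Require Import ereal topology normedtype sequences esum.
From mathcomp Require Import ring lra.
From mathcomp Require summability.

(* Complex Hilbert spaces over R[i], their bounded operators and reflexive
   algebras; the full Fock space with weighted shifts and its symmetric part.
   Scalars are R[i] for an arbitrary R : realType. Operators are functions,
   and B(H) is the set [bounded_operator]. *)

Set Implicit Arguments.
Unset Strict Implicit.
Unset Printing Implicit Defensive.

Import Order.TTheory GRing.Theory Num.Theory.
Import numFieldNormedType.Exports.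

Local Open Scope classical_set_scope.
Local Open Scope complex_scope.
Local Open Scope ring_scope.

HB.instance Definition _ (R : realType) := NormedModule.copy R[i] R[i]^o.

Section complex_complete.
Variable R : realType.

Lemma normr_normc (x : R[i]) : `|x| = (Normc.normc x)%:C.
Proof. by []. Qed.

Lemma normc_ge_ReIm (x : R[i]) :
  `|complex.Re x| <= Normc.normc x /\ `|complex.Im x| <= Normc.normc x.
Proof.
case: x => a b /=; rewrite -!sqrtr_sqr !ler_wsqrtr//.
  by rewrite lerDr sqr_ge0.
by rewrite lerDl sqr_ge0.
Qed.

Lemma normc_le_ReIm (x : R[i]) :
  Normc.normc x <= `|complex.Re x| + `|complex.Im x|.
Proof.
case: x => a b /=.
have h : 0 <= `|a| + `|b| by rewrite addr_ge0.
rewrite -(ger0_norm h) -sqrtr_sqr ler_wsqrtr// sqrrD !real_normK ?num_real//.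
by rewrite lerD2r lerDl mulrn_wge0 ?mulr_ge0.
Qed.

Lemma complex_cauchy_cvg (F : set_system R[i]) :
  ProperFilter F -> cauchy F -> cvg F.
Proof.
move=> FF /cauchy_ballP Fc.
have FcR : cauchy (@complex.Re R @ F).
  apply/cauchy_ballP => e e0.
  have e0C : 0 < e%:C by rewrite ltcR.
  have [[A B] [/= FA FB] AB] := Fc _ e0C.
  exists ([set complex.Re z | z in A], [set complex.Re z | z in B]).
    by split=> /=; [apply: filterS FA|apply: filterS FB] => z zA; exists z.
  move=> [_ _] /= [[z Az <-] [w Bw <-]].
  have := AB (z, w) (conj Az Bw); rewrite -!ball_normE/= normr_normc ltcR.
  apply: le_lt_trans; rewrite -raddfB/=.
  by case: (normc_ge_ReIm (z - w)).
have FcI : cauchy (@complex.Im R @ F).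
  apply/cauchy_ballP => e e0.
  have e0C : 0 < e%:C by rewrite ltcR.
  have [[A B] [/= FA FB] AB] := Fc _ e0C.
  exists ([set complex.Im z | z in A], [set complex.Im z | z in B]).
    by split=> /=; [apply: filterS FA|apply: filterS FB] => z zA; exists z.
  move=> [_ _] /= [[z Az <-] [w Bw <-]].
  have := AB (z, w) (conj Az Bw); rewrite -!ball_normE/= normr_normc ltcR.
  apply: le_lt_trans; rewrite -raddfB/=.
  by case: (normc_ge_ReIm (z - w)).
have ha : @complex.Re R @ F --> lim (@complex.Re R @ F).
  exact: cauchy_cvg FcR.
set a := lim _ in ha.
have hb : @complex.Im R @ F --> lim (@complex.Im R @ F).
  exact: cauchy_cvg FcI.
set b := lim _ in hb.
apply/cvg_ex; exists (a +i* b); apply/cvgrPdist_lt => e.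
case: e => e e'; rewrite ltcE/= => /andP[/eqP -> e0].
have e20 : 0 < e / 2 by rewrite divr_gt0.
move/cvgrPdist_lt : ha => /(_ _ e20) ha.
move/cvgrPdist_lt : hb => /(_ _ e20) hb.
rewrite !near_map in ha hb.
near=> z.
rewrite normr_normc -[X in _ < X]/(e%:C) ltcR.
apply: le_lt_trans (normc_le_ReIm _) _; rewrite (splitr e).
rewrite !raddfB/= ltrD//.
  by near: z.
by near: z.
Unshelve. all: by end_near. Qed.

HB.instance Definition _ := Uniform_isComplete.Build R[i] complex_cauchy_cvg.

End complex_complete.

(* The inner product is linear in its first argument. *)
HB.mixin Record NormedModule_hasInner (R : realType) H
    of NormedModule R[i] H := {
  inner : H -> H -> R[i];
  innerPl : forall a x y z, inner (a *: x + y) z = a * inner x z + inner y z;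
  inner_conj : forall x y, inner x y = (inner y x)^*;
  innerxx : forall x, inner x x = `|x| ^+ 2
}.

#[short(type="preHilbertType")]
HB.structure Definition PreHilbert (R : realType) :=
  {H of NormedModule R[i] H & NormedModule_hasInner R H}.

#[short(type="hilbertType")]
HB.structure Definition Hilbert (R : realType) :=
  {H of PreHilbert R H & Complete H}.

HB.factory Record Lmodule_hasInner (R : realType) H of GRing.Lmodule R[i] H := {
  inner : H -> H -> R[i];
  innerPl : forall a x y z, inner (a *: x + y) z = a * inner x z + inner y z;
  inner_conj : forall x y, inner x y = (inner y x)^*;
  inner_ge0 : forall x, 0 <= inner x x;
  inner_eq0 : forall x, inner x x = 0 -> x = 0
}.

HB.builders Context R H of Lmodule_hasInner R H.

Let norm (x : H) : R[i] := sqrtC (inner x x).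

Let inner0l z : inner 0 z = 0.
Proof.
have := innerPl 1 0 0 z; rewrite scale1r addr0 mul1r => /eqP.
by rewrite -subr_eq0 opprD addNKr oppr_eq0 => /eqP.
Qed.

Let innerDl x y z : inner (x + y) z = inner x z + inner y z.
Proof. by rewrite -[x in LHS]scale1r innerPl mul1r. Qed.

Let innerZl a x z : inner (a *: x) z = a * inner x z.
Proof. by rewrite -[a *: x]addr0 innerPl inner0l addr0. Qed.

Let innerDr x y z : inner z (x + y) = inner z x + inner z y.
Proof. by rewrite inner_conj innerDl rmorphD/= -!inner_conj. Qed.

Let innerZr a x z : inner z (a *: x) = a^* * inner z x.
Proof. by rewrite inner_conj innerZl rmorphM/= -inner_conj. Qed.

Let normZ a x : norm (a *: x) = `|a| * norm x.
Proof.
rewrite /norm innerZl innerZr mulrA -normCK.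
have a0 : `|a| ^+ 2 \is Num.nneg by rewrite nnegrE exprn_ge0.
have x0 : inner x x \is Num.nneg by rewrite nnegrE inner_ge0.
by rewrite sqrtCM// sqrCK.
Qed.

Let norm_eq0 x : norm x = 0 -> x = 0.
Proof. by move/eqP; rewrite sqrtC_eq0 => /eqP; exact: inner_eq0. Qed.

Let inner_CS x y : `|inner x y| ^+ 2 <= inner x x * inner y y.
Proof.
have [y0|y0] := eqVneq (inner y y) 0.
  rewrite (inner_eq0 y0) inner_conj !inner0l rmorph0 normr0 expr0n mulr0.
  by rewrite lexx.
have ygt0 : 0 < inner y y by rewrite lt_def y0 inner_ge0.
have := inner_ge0 (inner y y *: x + (- inner x y) *: y).
have -> : inner (inner y y *: x + - inner x y *: y)
                (inner y y *: x + - inner x y *: y) =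
    inner y y * (inner x x * inner y y - inner x y * inner y x).
  rewrite innerDl !innerDr !innerZl !innerZr rmorphN/= -!inner_conj; ring.
by rewrite pmulr_rge0// subr_ge0 normCK -inner_conj.
Qed.

Let ler_norm_add x y : norm (x + y) <= norm x + norm y.
Proof.
have n0 z : 0 <= norm z by rewrite sqrtC_ge0 inner_ge0.
rewrite -[leLHS]sqrCK ?n0// -[leRHS]sqrCK ?addr_ge0 ?n0//.
rewrite ler_sqrtC ?qualifE/= ?exprn_ge0 ?addr_ge0 ?n0//.
rewrite sqrrD !sqrtCK innerDl !innerDr addrA lerD2r -!addrA lerD2l.
rewrite (inner_conj y x).
have zR : inner x y + (inner x y)^* \is Num.real.
  by rewrite CrealE rmorphD/= conjCK addrC.
apply: le_trans (real_ler_norm zR) _; apply: le_trans (ler_normD _ _) _.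
rewrite norm_conjC -mulr2n lerMn2r/=.
rewrite -[leLHS]sqrCK// -sqrtCM ?nnegrE ?inner_ge0// ler_sqrtC//.
  by rewrite qualifE/= exprn_ge0.
by rewrite qualifE/= mulr_ge0 ?inner_ge0.
Qed.

HB.instance Definition _ :=
  @Lmodule_isNormed.Build R[i] H norm ler_norm_add normZ norm_eq0.

HB.instance Definition _ := @NormedModule_hasInner.Build R H inner innerPl
  inner_conj (fun x => esym (sqrtCK _)).

HB.end.

#[global] Existing Instance summability.totally_filter.

Lemma normc_ge0 (R : realType) (x : R[i]) : 0 <= Normc.normc x.
Proof. by case: x => a b; rewrite /= sqrtr_ge0. Qed.

Section unconditional_sums.
Variables (R : realType) (I : choiceType).
Implicit Types (f g : I -> R[i]) (A : {fset I}).

Lemma partial_sumE f A : summability.partial_sum f A = \sum_(a <- A) f a.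
Proof. by rewrite /summability.partial_sum big_seq_fsetE. Qed.

Lemma sum_fsetID (V : zmodType) (f : I -> V) A B : (A `<=` B)%fset ->
  \sum_(a <- B) f a = \sum_(a <- A) f a + \sum_(a <- (B `\` A)%fset) f a.
Proof.
move=> AB; rewrite (big_fsetID _ (mem A))/=; congr (_ + _); apply: perm_big.
  rewrite uniq_perm// => a; rewrite !inE/=; case aA: (a \in A); rewrite ?andbF//.
  by rewrite (fsubsetP AB).
by rewrite uniq_perm// => a; rewrite !inE/= andbC.
Qed.

Lemma ler_sum_fset (g : I -> R) A B : (forall a, 0 <= g a) -> (A `<=` B)%fset ->
  \sum_(a <- A) g a <= \sum_(a <- B) g a.
Proof.
by move=> g0 AB; rewrite (sum_fsetID _ AB) lerDl sumr_ge0.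
Qed.

Lemma esum_leP (g : I -> R) (M : R) : (forall a, 0 <= g a) ->
  (\esum_(a in [set: I]) (g a)%:E <= M%:E)%E <->
  forall A, \sum_(a <- A) g a <= M.
Proof.
move=> g0; split=> [+ A|gM].
  move=> /(le_trans _) gM; rewrite -lee_fin; apply: gM.
  apply: esum_ge; exists [set` A] => //.
  by rewrite fsbig_finite//= set_fsetK sumEFin.
apply: ge_ereal_sup => /= _ [X [finX _] <-].
by rewrite fsbig_finite//= sumEFin lee_fin.
Qed.

Lemma esum_ltP (g : I -> R) : (forall a, 0 <= g a) ->
  (\esum_(a in [set: I]) (g a)%:E < +oo)%E <->
  exists M, forall A, \sum_(a <- A) g a <= M.
Proof.
move=> g0; split=> [gy|[M gM]].
  exists (fine (\esum_(a in [set: I]) (g a)%:E)).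
  apply/(esum_leP _ g0); rewrite fineK// ge0_fin_numE//.
  by apply: esum_ge0 => a _; rewrite lee_fin.
apply: (@le_lt_trans _ _ M%:E); last by rewrite ltry.
exact/(esum_leP _ g0).
Qed.

Lemma cvg_partial_sum f (M : R) :
  (forall A, \sum_(a <- A) Normc.normc (f a) <= M) ->
  summability.partial_sum f @ summability.totally --> summability.sum f.
Proof.
move=> fM.
pose S := [set \sum_(a <- A) Normc.normc (f a) | A in [set: {fset I}]].
have S_sup : has_sup S.
  split; first by exists (\sum_(a <- fset0) Normc.normc (f a)), fset0.
  by exists M => _ [A _ <-].
have n0 a : 0 <= Normc.normc (f a) by exact: normc_ge0.
apply: (@cauchy_cvg R[i] (summability.partial_sum f @ summability.totally)).
apply/cauchy_ballP => -[e e']; rewrite ltcE/= => /andP[/eqP -> e0].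
have e20 : 0 < e / 2 by rewrite divr_gt0.
have [_ [A0 _ <-] A0e] := sup_adherent e20 S_sup.
have small A : (A0 `<=` A)%fset ->
    Normc.normc (\sum_(a <- A) f a - \sum_(a <- A0) f a) < e / 2.
  move=> A0A; rewrite (sum_fsetID _ A0A) addrAC subrr add0r.
  apply: (@le_lt_trans _ _ (\sum_(a <- (A `\` A0)%fset) Normc.normc (f a))).
    rewrite -lecR -normr_normc rmorph_sum/=; exact: ler_norm_sum.
  rewrite -(ltrD2l (\sum_(a <- A0) Normc.normc (f a))) -sum_fsetID//.
  apply: (@le_lt_trans _ _ (sup S)); last by rewrite -ltrBlDr.
  by apply: (sup_upper_bound S_sup); exists A.
exists ([set \sum_(a <- A) f a | A in [set A | A0 `<=` A]%fset],
        [set \sum_(a <- A) f a | A in [set A | A0 `<=` A]%fset]).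
  by split; exists A0 => //= A A0A; exists A; rewrite ?partial_sumE.
move=> [_ _] /= [[A A0A <-] [B A0B <-]].
rewrite -ball_normE/= normr_normc -[X in _ < X]/(e%:C) ltcR (splitr e).
set u := \sum_(a <- A0) f a in small.
rewrite -(subrKA u); apply: le_lt_trans (le_normcD _ _) _.
by rewrite ltrD// ?small// -opprB normcN small.
Qed.

End unconditional_sums.

Section ell2.
Variables (R : realType) (I : choiceType).

Definition square_summable (x : I -> R[i]) : Prop :=
  (\esum_(a in [set: I]) (Normc.normc (x a) ^+ 2)%:E < +oo)%E.

Definition square_summable_pred : {pred I -> R[i]} :=
  fun x => `[< square_summable x >].

Lemma square_summableP (x : I -> R[i]) :
  square_summable x <->
  exists M, forall A : {fset I}, \sum_(a <- A) Normc.normc (x a) ^+ 2 <= M.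
Proof. by apply: esum_ltP => a; rewrite sqr_ge0. Qed.

Lemma normcZ (a x : R[i]) : Normc.normc (a *: x) = Normc.normc a * Normc.normc x.
Proof. exact: Normc.normcM. Qed.

Lemma normcD_sqr (x y : R[i]) : Normc.normc (x + y) ^+ 2 <=
  2 * Normc.normc x ^+ 2 + 2 * Normc.normc y ^+ 2.
Proof.
have := le_normcD x y; move: (normc_ge0 (x + y)) (normc_ge0 x) (normc_ge0 y).
set a := Normc.normc (x + y); set b := Normc.normc x; set c := Normc.normc y.
move=> a0 b0 c0 abc.
have : a ^+ 2 <= (b + c) ^+ 2 by rewrite lerXn2r// nnegrE addr_ge0.
have := sqr_ge0 (b - c); rewrite !expr2 => h1 h2; lra.
Qed.

Lemma square_summable_closed : submod_closed square_summable_pred.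
Proof.
split=> [|a x y /asboolP/square_summableP[M xM] /asboolP/square_summableP[N yN]].
  apply/asboolP/square_summableP; exists 0 => A.
  by rewrite big1// => a _; rewrite Normc.normc0 expr0n.
apply/asboolP/square_summableP.
exists (2 * Normc.normc a ^+ 2 * M + 2 * N) => A.
apply: (@le_trans _ _ (\sum_(i <- A) (2 * Normc.normc a ^+ 2 * Normc.normc (x i) ^+ 2 +
    2 * Normc.normc (y i) ^+ 2))).
  apply: ler_sum => i _; apply: le_trans (normcD_sqr _ _) _.
  by rewrite normcZ exprMn mulrA.
rewrite big_split/= -!mulr_sumr lerD// ler_wpM2l//.
by rewrite mulr_ge0 ?sqr_ge0.
Qed.

HB.instance Definition _ :=
  GRing.isSubmodClosed.Build R[i] (I -> R[i]) square_summable_pred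
    square_summable_closed.

Record ell2 : Type := Ell2 {
  ell2_fun :> I -> R[i];
  _ : ell2_fun \in square_summable_pred }.

HB.instance Definition _ := [isSub for ell2_fun].
HB.instance Definition _ := [Choice of ell2 by <:].
HB.instance Definition _ := [SubChoice_isSubLmodule of ell2 by <:].

Lemma ell2P (x : ell2) :
  exists M, forall A : {fset I}, \sum_(a <- A) Normc.normc (x a) ^+ 2 <= M.
Proof. by apply/square_summableP/asboolP; exact: valP x. Qed.

Definition ell2_inner (x y : ell2) : R[i] :=
  summability.sum (fun a => x a * (y a)^*).

Lemma normcM_le (x y : R[i]) : Normc.normc (x * y^*) <=
  Normc.normc x ^+ 2 + Normc.normc y ^+ 2.
Proof.
have -> : Normc.normc (x * y^*) = Normc.normc x * Normc.normc y.
  rewrite Normc.normcM; congr (_ * _); case: y => a b /=.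
  by rewrite sqrrN.
move: (normc_ge0 x) (normc_ge0 y).
set a := Normc.normc x; set b := Normc.normc y => a0 b0.
have := sqr_ge0 (a - b); have := mulr_ge0 a0 b0; rewrite !expr2; lra.
Qed.

Lemma cvg_ell2_inner (x y : ell2) :
  summability.partial_sum (fun a => x a * (y a)^*) @ summability.totally -->
  ell2_inner x y.
Proof.
have [M xM] := ell2P x; have [N yN] := ell2P y.
apply: (@cvg_partial_sum _ _ _ (M + N)) => A.
apply: (@le_trans _ _ (\sum_(a <- A) (Normc.normc (x a) ^+ 2 +
    Normc.normc (y a) ^+ 2))).
  by apply: ler_sum => a _; exact: normcM_le.
by rewrite big_split lerD.
Qed.

Lemma ell2_innerPl a (x y z : ell2) :
  ell2_inner (a *: x + y) z = a * ell2_inner x z + ell2_inner y z.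
Proof.
apply: (cvg_unique _ (@cvg_ell2_inner _ _)) => //.
have -> : summability.partial_sum (fun b => (a *: x + y) b * (z b)^*) =
    (fun A => a * summability.partial_sum (fun b => x b * (z b)^*) A +
              summability.partial_sum (fun b => y b * (z b)^*) A).
  apply/funext => A; rewrite !partial_sumE mulr_sumr -big_split/=.
  by apply: eq_bigr => b _; rewrite mulrDl mulrA.
apply: cvgD; last exact: cvg_ell2_inner.
apply: cvgM; first exact: cvg_cst.
exact: cvg_ell2_inner.
Qed.

Lemma conjC_continuous : continuous (Num.conj : R[i] -> R[i]).
Proof.
move=> x; apply/(@cvgrPdist_lt _ _ _ (nbhs x)) => e e0.
apply: filterS (nbhsx_ballx x e e0) => z.
by rewrite -ball_normE/= -rmorphB norm_conjC.
Qed.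

Lemma ell2_inner_conj (x y : ell2) : ell2_inner x y = (ell2_inner y x)^*.
Proof.
apply: (cvg_unique _ (@cvg_ell2_inner _ _)) => //.
have -> : summability.partial_sum (fun b => x b * (y b)^*) =
    (Num.conj : R[i] -> R[i]) \o summability.partial_sum (fun b => y b * (x b)^*).
  apply/funext => A /=; rewrite !partial_sumE rmorph_sum/=.
  by apply: eq_bigr => b _; rewrite rmorphM/= conjCK mulrC.
apply: cvg_comp; first exact: cvg_ell2_inner.
exact: conjC_continuous.
Qed.

Lemma normc_continuous : continuous (@Normc.normc R).
Proof.
move=> x; apply/(@cvgrPdist_lt _ _ _ (nbhs x)) => e e0.
have e0C : 0 < e%:C by rewrite ltcR.
apply: filterS (nbhsx_ballx x e%:C e0C) => z; rewrite -ball_normE/= normr_normc ltcR; apply: le_lt_trans.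
have h1 : Normc.normc x <= Normc.normc (x - z) + Normc.normc z.
  by have := le_normcD (x - z) z; rewrite subrK.
have h2 : Normc.normc z <= Normc.normc (x - z) + Normc.normc x.
  by have := le_normcD (z - x) x; rewrite subrK -(opprB x z) normcN.
by rewrite ler_norml; apply/andP; split; lra.
Qed.

Definition ell2_sqr (x : ell2) : R :=
  sup [set \sum_(a <- A) Normc.normc (x a) ^+ 2 | A in [set: {fset I}]].

Lemma ell2_sqr_has_sup (x : ell2) :
  has_sup [set \sum_(a <- A) Normc.normc (x a) ^+ 2 | A in [set: {fset I}]].
Proof.
have [M xM] := ell2P x; split; last by exists M => _ [A _ <-].
by exists (\sum_(a <- fset0) Normc.normc (x a) ^+ 2), fset0.
Qed.

Lemma ell2_innerxx (x : ell2) : ell2_inner x x = (ell2_sqr x)%:C.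
Proof.
apply: (cvg_unique _ (@cvg_ell2_inner x x)) => //.
apply/cvgrPdist_lt => -[e e']; rewrite ltcE/= => /andP[/eqP -> e0].
have [_ [A0 _ <-] A0e] := sup_adherent e0 (ell2_sqr_has_sup x).
exists A0 => //= A A0A; rewrite partial_sumE.
have -> : \sum_(a <- A) x a * (x a)^* =
    (\sum_(a <- A) Normc.normc (x a) ^+ 2)%:C.
  rewrite rmorph_sum/=; apply: eq_bigr => a _.
  by rewrite -normCK normr_normc rmorphXn.
rewrite -rmorphB normr_normc/= -[X in _ < X]/(e%:C) ltcR expr0n addr0 sqrtr_sqr.
rewrite ger0_norm.
  rewrite ltrBlDr -ltrBlDl; apply: lt_le_trans A0e _.
  by apply: ler_sum_fset => // a; rewrite sqr_ge0.
rewrite subr_ge0; apply: (sup_upper_bound (ell2_sqr_has_sup x)).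
by exists A.
Qed.

Lemma ell2_sqr_leP (x : ell2) (r : R) : ell2_sqr x <= r <->
  forall A : {fset I}, \sum_(a <- A) Normc.normc (x a) ^+ 2 <= r.
Proof.
have xs := ell2_sqr_has_sup x; split=> [xr A|xr].
  by apply: le_trans xr; apply: (sup_upper_bound xs); exists A.
by apply: ge_sup; [case: xs|move=> _ [A _ <-]].
Qed.

Lemma ell2_sqr_ge0 (x : ell2) : 0 <= ell2_sqr x.
Proof.
have /(_ fset0) := (ell2_sqr_leP x (ell2_sqr x)).1 (lexx _).
by rewrite big_seq_fset0.
Qed.

Lemma ell2_inner_ge0 (x : ell2) : 0 <= ell2_inner x x.
Proof. by rewrite ell2_innerxx lecR ell2_sqr_ge0. Qed.

Lemma ell2_inner_eq0 (x : ell2) : ell2_inner x x = 0 -> x = 0.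
Proof.
rewrite ell2_innerxx => /complexI x0; apply: val_inj; apply/funext => a /=.
have := (ell2_sqr_leP x 0).1; rewrite x0 lexx => /(_ isT [fset a]%fset).
rewrite big_seq_fset1 => xa.
have : Normc.normc (x a) ^+ 2 == 0 by rewrite eq_le xa sqr_ge0.
by rewrite sqrf_eq0 => /eqP/Normc.eq0_normc.
Qed.

HB.instance Definition _ := Lmodule_hasInner.Build R ell2
  ell2_innerPl ell2_inner_conj ell2_inner_ge0 ell2_inner_eq0.

Lemma ell2_norm_leP (x : ell2) (r : R) : 0 <= r -> `|x| <= r%:C <->
  forall A : {fset I}, \sum_(a <- A) Normc.normc (x a) ^+ 2 <= r ^+ 2.
Proof.
move=> r0; rewrite -ell2_sqr_leP -[ell2_sqr x <= _]lecR -ell2_innerxx.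
rewrite -[ell2_inner x x]/(inner x x) innerxx rmorphXn/=.
have rC : 0 <= r%:C by rewrite lecR.
by rewrite ler_sqr// nnegrE.
Qed.

Lemma ell2_coord_le (x : ell2) (a : I) : `|x a| <= `|x|.
Proof.
rewrite -ler_sqr ?nnegrE// -innerxx -[inner x x]/(ell2_inner x x) ell2_innerxx.
rewrite normr_normc -rmorphXn/= lecR.
have := (ell2_sqr_leP x _).1 (lexx _) [fset a]%fset.
by rewrite big_seq_fset1.
Qed.

Lemma cvg_sumr (T : Type) (F : set_system T) (FF : Filter F) (J : Type)
    (s : seq J) (f : J -> T -> R) (l : J -> R) :
  (forall j, f j @ F --> l j) ->
  (fun t => \sum_(j <- s) f j t) @ F --> \sum_(j <- s) l j.
Proof.
move=> fl; elim: s => [|j s IH].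
  by under eq_cvg do rewrite big_nil; rewrite big_nil; exact: cvg_cst.
rewrite big_cons; under eq_cvg do rewrite big_cons; exact: cvgD.
Qed.

Lemma ell2_complete (F : set_system ell2) : ProperFilter F -> cauchy F -> cvg F.
Proof.
move=> FF /cauchy_ballP Fc.
have Fe (e : R) : 0 < e -> F [set x : ell2 | F [set y : ell2 |
    forall A : {fset I}, \sum_(a <- A) Normc.normc (x a - y a) ^+ 2 <= e ^+ 2]].
  move=> e0; have e0C : 0 < e%:C by rewrite ltcR.
  have [[P Q] [/= FP FQ] PQ] := Fc _ e0C.
  apply: filterS FP => x Px; apply: filterS FQ => y Qy.
  apply/(ell2_norm_leP (x - y) (ltW e0)).
  by have := PQ (x, y) (conj Px Qy); rewrite -ball_normE/= => /ltW.
pose p (a : I) (x : ell2) : R[i] := x a.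
have pF a : p a @ F --> lim (p a @ F).
  apply: (@cauchy_cvg R[i] (p a @ F)); apply/cauchy_ballP => e e0.
  have [[P Q] [/= FP FQ] PQ] := Fc _ e0.
  exists ([set p a x | x in P], [set p a x | x in Q]).
    by split=> /=; [apply: filterS FP|apply: filterS FQ] => z zP; exists z.
  move=> [_ _] /= [[x Px <-] [y Qy <-]].
  have := PQ (x, y) (conj Px Qy); rewrite -!ball_normE/=; apply: le_lt_trans.
  exact: (ell2_coord_le (x - y)).
pose l : I -> R[i] := fun a => lim (p a @ F).
have Fl (e : R) : 0 < e -> F [set x : ell2 |
    forall A : {fset I}, \sum_(a <- A) Normc.normc (x a - l a) ^+ 2 <= e ^+ 2].
  move=> e0; apply: filterS (Fe _ e0) => x xe A.
  apply: (@cvgr_to_le _ F _ _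
    (fun y : ell2 => \sum_(a <- A) Normc.normc (x a - y a) ^+ 2)); last first.
    by apply: filterS xe => y; exact.
  apply: cvg_sumr => a.
  apply: (@cvg_comp _ _ _ (fun y : ell2 => x a - p a y)
    (fun z : R[i] => Normc.normc z ^+ 2) F (nbhs (x a - l a))).
    by apply: cvgB; [exact: cvg_cst|exact: pF].
  by apply: cvgM; exact: normc_continuous.
have lS : l \in square_summable_pred.
  have /filter_ex[x0 x0l] := Fl _ ltr01.
  have dS : (x0 : I -> R[i]) - l \in square_summable_pred.
    by apply/asboolP/square_summableP; exists (1 ^+ 2) => A; exact: x0l.
  have -> : l = (x0 : I -> R[i]) - ((x0 : I -> R[i]) - l) by rewrite opprB addrC subrK.
  by rewrite rpredB//; exact: valP x0.
apply: (@cvgP _ _ (Ell2 lS)).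
apply/(@cvgrPdist_le _ _ _ F) => -[e e']; rewrite ltcE/= => /andP[/eqP -> e0].
apply: filterS (Fl _ e0) => x xe; rewrite distrC.
exact/(ell2_norm_leP (x - Ell2 lS) (ltW e0)).
Qed.

HB.instance Definition _ := Uniform_isComplete.Build ell2 ell2_complete.

End ell2.

Section closed_subspaces.
Variables (R : realType) (H : hilbertType R).

Definition closed_subspace (M : set H) : Prop :=
  [/\ M 0, forall (a : R[i]) x y, M x -> M y -> M (a *: x + y) & closed M].

Definition closed_span (S : set H) : set H := smallest closed_subspace S.

Lemma closed_subspace_span (S : set H) : closed_subspace (closed_span S).
Proof.
split=> [M [[M0 _ _] _]//|a x y Sx Sy M MS|].
  have [[_ Mlin _] _] := MS.
  by apply: Mlin; [exact: Sx|exact: Sy].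
by apply: closed_bigI => M [[]].
Qed.

Record closedSubspace : Type := ClosedSubspace {
  csub_set :> set H;
  csub_setP : closed_subspace csub_set }.

Section as_hilbert_space.
Variable M : closedSubspace.

Definition csub_pred : {pred H} := fun x => `[< csub_set M x >].

Lemma csub_submod_closed : submod_closed csub_pred.
Proof.
have [M0 Mlin _] := csub_setP M; split=> [|a x y /asboolP Mx /asboolP My].
  exact/asboolP.
by apply/asboolP; exact: Mlin.
Qed.

HB.instance Definition _ :=
  GRing.isSubmodClosed.Build R[i] H csub_pred csub_submod_closed.

Record csub : Type := CSub { csub_val :> H; _ : csub_val \in csub_pred }.

HB.instance Definition _ := [isSub for csub_val].
HB.instance Definition _ := [Choice of csub by <:].
HB.instance Definition _ := [SubChoice_isSubLmodule of csub by <:].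

Let csub_inner (x y : csub) : R[i] := inner (csub_val x) (csub_val y).

Let csub_innerPl a (x y z : csub) :
  csub_inner (a *: x + y) z = a * csub_inner x z + csub_inner y z.
Proof. exact: innerPl. Qed.

Let csub_inner_conj (x y : csub) : csub_inner x y = (csub_inner y x)^*.
Proof. exact: inner_conj. Qed.

Let csub_inner_ge0 (x : csub) : 0 <= csub_inner x x.
Proof. by rewrite /csub_inner innerxx exprn_ge0. Qed.

Let csub_inner_eq0 (x : csub) : csub_inner x x = 0 -> x = 0.
Proof.
rewrite /csub_inner innerxx => /eqP; rewrite sqrf_eq0 normr_eq0 => /eqP x0.
exact: val_inj.
Qed.

HB.instance Definition _ := Lmodule_hasInner.Build R csub
  csub_innerPl csub_inner_conj csub_inner_ge0 csub_inner_eq0.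

Lemma csub_normE (x : csub) : `|x| = `|csub_val x|.
Proof. by apply: (pexpIrn (n := 2)); rewrite ?nnegrE// -!innerxx. Qed.

Lemma csub_complete (F : set_system csub) : ProperFilter F -> cauchy F -> cvg F.
Proof.
move=> FF /cauchy_ballP Fc.
have vF : csub_val @ F --> lim (csub_val @ F).
  apply: (@cauchy_cvg H (csub_val @ F)); apply/cauchy_ballP => e e0.
  have [[P Q] [/= FP FQ] PQ] := Fc _ e0.
  exists ([set csub_val x | x in P], [set csub_val x | x in Q]).
    by split=> /=; [apply: filterS FP|apply: filterS FQ] => z zP; exists z.
  move=> [_ _] /= [[x Px <-] [y Qy <-]].
  by have := PQ (x, y) (conj Px Qy); rewrite -!ball_normE/= csub_normE.
set l := lim _ in vF.
have lM : l \in csub_pred.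
  have [_ _ Mcl] := csub_setP M; apply/asboolP.
  apply: (closed_cvg _ Mcl _ _ vF).
  by apply: nearW => x; exact/asboolP/(valP x).
apply: (@cvgP _ _ (CSub lM)); apply/(@cvgrPdist_lt _ _ _ F) => e e0.
move/(@cvgrPdist_lt _ _ _ F) : vF => /(_ e e0).
by apply: filterS => x; rewrite csub_normE.
Qed.

HB.instance Definition _ := Uniform_isComplete.Build csub csub_complete.

End as_hilbert_space.

(* [xget] picks the unique point of [M] with [x - p] orthogonal to [M]. *)
Definition orth_proj (M : closedSubspace) (x : H) : csub M :=
  xget 0 [set p : csub M |
    forall y : csub M, inner (x - csub_val p) (csub_val y) = 0].

End closed_subspaces.

Section operators.
Variables (R : realType) (H : hilbertType R).
Implicit Types (S T : H -> H) (U : set (H -> H)) (L : set (set H)).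

Definition bounded_operator : set (H -> H) :=
  [set T | linear T /\ exists K : R, forall x, `|T x| <= K%:C * `|x|].

Definition norm_square_summable (x : nat -> H) : Prop :=
  cvgn (series (fun k => `|x k| ^+ 2)).

(* For x, y with finite sums of squares of norms, these are the maps
   T |-> tr (T C) with C trace class, i.e. the predual of B(H). *)
Definition trace_functional (x y : nat -> H) T : R[i] :=
  limn (series (fun k => inner (T (x k)) (y k))).

Definition wstar_closed U : Prop :=
  U `<=` bounded_operator /\
  forall T, bounded_operator T ->
    (forall (m : nat) (x y : 'I_m -> nat -> H) (e : R),
      (forall j, norm_square_summable (x j)) ->
      (forall j, norm_square_summable (y j)) -> 0 < e ->
      exists2 S, U S & forall j,
        `|trace_functional (x j) (y j) S - trace_functional (x j) (y j) T|
          < e%:C) ->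
    U T.

Definition unital_subalgebra U : Prop :=
  [/\ U `<=` bounded_operator, U idfun,
      forall (a : R[i]) S T, U S -> U T -> U (fun x => a *: S x + T x) &
      forall S T, U S -> U T -> U (S \o T)].

Definition wstar_algebra_generated (G : set (H -> H)) : set (H -> H) :=
  smallest (fun U => unital_subalgebra U /\ wstar_closed U) G.

Definition Lat U : set (set H) :=
  [set M | closed_subspace M /\ forall T, U T -> T @` M `<=` M].

Definition Alg L : set (H -> H) :=
  [set T | bounded_operator T /\ L `<=` Lat [set T]].

Definition reflexive_algebra U : Prop := U = Alg (Lat U).

End operators.

(* Words over the alphabet 'I_n form the free semigroup: [::] is g_0 and
   concatenation is the product. *)
Notation word n := (seq 'I_n).
Notation fock R n := (ell2 R (word n)).

Section weighted_shifts.
Variables (R : realType) (n : nat).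

(* The product of mu over all nonempty suffixes of the word. *)
Fixpoint wprod (mu : word n -> R) (a : word n) : R :=
  if a is _ :: b then mu a * wprod mu b else 1.

(* The value of a weight sequence at the empty word is irrelevant. The last two
   fields say that the weighted left and right multi-shifts are bounded. *)
Record weight_sequence : Type := WeightSequence {
  weight :> word n -> R;
  weight_gt0 : forall b, b != [::] -> 0 < weight b;
  weight_left_bounded : forall i : 'I_n,
    has_ubound (range (fun a => weight (i :: a)));
  weight_right_bounded : forall i : 'I_n,
    has_ubound (range (fun a => wprod weight (rcons a i) / wprod weight a)) }.

Definition fock_basis_fun (a : word n) : word n -> R[i] :=
  fun b => (b == a)%:R.

Lemma fock_basis_subproof a : fock_basis_fun a \in square_summable_pred (I := word n).
Proof.
apply/asboolP/square_summableP; exists 1 => A.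
have [aA|aA] := boolP (a \in A).
  rewrite (big_fsetD1 a)//= /fock_basis_fun eqxx Normc.normc1 expr1n.
  rewrite big_seq big1 ?addr0// => b; rewrite !inE => /andP[/negPf -> _].
  by rewrite Normc.normc0 expr0n.
rewrite big_seq big1// => b bA; rewrite /fock_basis_fun.
rewrite (_ : (b == a) = false) ?Normc.normc0 ?expr0n//.
by apply: contraNF aA => /eqP <-.
Qed.

Definition fock_basis (a : word n) : fock R n := Ell2 (fock_basis_subproof a).

Variable mu : weight_sequence.

(* Coordinatewise form of W_i e_a = mu_(g_i a) e_(g_i a);
   see [left_shift_basis]. *)
Definition left_shift_fun (i : 'I_n) (x : word n -> R[i]) : word n -> R[i] :=
  fun b => if b is j :: a then if j == i then (mu b)%:C * x a else 0 else 0.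

Lemma left_shift_subproof i (x : fock R n) :
  left_shift_fun i x \in square_summable_pred (I := word n).
Proof.
apply/asboolP/square_summableP; have [M xM] := ell2P x.
have [K0 K0P] := weight_left_bounded mu i; pose K := `|K0|.
have K_ge0 : 0 <= K by exact: normr_ge0.
have muK a : `|mu (i :: a)| <= K.
  rewrite gtr0_norm ?weight_gt0//; apply: le_trans (ler_norm _).
  by apply: K0P; exists a.
exists (K ^+ 2 * M) => A.
pose B := [fset b in A | ohead b == Some i]%fset.
have BA : (B `<=` A)%fset by apply/fsubsetP => b; rewrite !inE => /andP[].
rewrite (sum_fsetID _ BA) [X in _ + X]big_seq [X in _ + X]big1 ?addr0; last first.
  move=> b bAB; suff -> : left_shift_fun i x b = 0.
    by rewrite Normc.normc0 expr0n.
  case: b bAB => [|j a] //=; case: eqP => // ->.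
  by rewrite !inE/= eqxx andbT => /andP[/negbTE->].
pose g (b : word n) := Normc.normc (x b) ^+ 2.
apply: (@le_trans _ _ (\sum_(b <- B) K ^+ 2 * g (behead b))).
  rewrite big_seq [leRHS]big_seq; apply: ler_sum => -[|j a]; rewrite !inE/= ?andbF//.
  move=> /andP[_ /eqP[->]]; rewrite eqxx Normc.normcM exprMn /g.
  rewrite ler_wpM2r ?sqr_ge0//= expr0n addr0 sqrtr_sqr.
  by apply: lerXn2r (muK a); rewrite ?nnegrE.
rewrite -mulr_sumr ler_wpM2l ?sqr_ge0//.
have binj : {in B &, injective (@behead 'I_n)}.
  move=> [|j a] [|k b]; rewrite !inE/= ?andbF//.
  by move=> /andP[_ /eqP[->]] /andP[_ /eqP[->]] ->.
by have := xM [fset behead b | b in B]%fset; rewrite big_imfset.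
Qed.

Definition left_shift (i : 'I_n) (x : fock R n) : fock R n :=
  Ell2 (left_shift_subproof i x).

Lemma left_shift_basis i a :
  left_shift i (fock_basis a) = (mu (i :: a))%:C *: fock_basis (i :: a).
Proof.
apply: val_inj; apply/funext => b.
rewrite -[RHS]/((mu (i :: a))%:C * fock_basis_fun (i :: a) b) /=.
rewrite /left_shift_fun /fock_basis_fun; case: b => [|j b]; first by rewrite mulr0.
rewrite eqseq_cons; case: eqP => [->|_] /=; last by rewrite mulr0.
by have [->|_] := eqVneq b a; rewrite ?mulr0.
Qed.

Definition word_monomial (l : 'rV[R[i]]_n) (a : word n) : R[i] :=
  \prod_(i <- a) l 0 i.

Definition convergence_domain : set 'rV[R[i]]_n :=
  [set l | (\esum_(a in [set: word n])
    (Normc.normc (word_monomial l a) ^+ 2 / wprod mu a ^+ 2)%:E < +oo)%E].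

Definition Lambda (k : 'I_n -> nat) : set (word n) :=
  [set a | forall l : 'rV[R[i]]_n,
    word_monomial l a = \prod_(i < n) l 0 i ^+ k i].

Definition omega (k : 'I_n -> nat) : R :=
  \sum_(a \in Lambda k) (wprod mu a ^+ 2)^-1.

Definition sym_vector (k : 'I_n -> nat) : fock R n :=
  (omega k)^-1%:C *: \sum_(a \in Lambda k) (wprod mu a)^-1%:C *: fock_basis a.

Definition sym_fock : closedSubspace (fock R n) :=
  ClosedSubspace (closed_subspace_span (range sym_vector)).

Definition compressed_shift (i : 'I_n) (x : csub sym_fock) : csub sym_fock :=
  orth_proj sym_fock (left_shift i (csub_val x)).

Definition sym_hardy_algebra : set (csub sym_fock -> csub sym_fock) :=
  wstar_algebra_generated (range compressed_shift).

End weighted_shifts.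

Arguments compressed_shift {R n} mu i x.
Arguments sym_hardy_algebra {R n} mu.

(* Main.v *)
(* The vectors y^(k) form an orthogonal basis on which B_i acts as a shift, and
   the functionals x |-> <x, v_l>, for l near the origin, send y^(k) to l^k.
   The kernel of such a functional is invariant for the algebra, hence for any
   T in Alg Lat; thus T acts on the values <x, v_l> as multiplication by a
   function of l, and T commutes with every B_i because the v_l separate points
   (a power series vanishing near the origin has zero coefficients).
   An operator commuting with the B_i is determined by the coefficients of
   T y^(0), and the Cesaro means of its formal power series in the B_i are

     (1/N) \sum_p Q_p T Q_p,

   where Q_p projects on the N consecutive degrees below p. This bounds them by
   the norm of T, so these polynomials in the B_i converge to T in the
   w*-topology. *)
Require Import Defs.
From mathcomp Require Import all_boot all_order all_algebra.
From mathcomp Require Import finmap complex.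
From mathcomp Require Import all_classical all_reals.
From mathcomp Require Import ereal topology normedtype sequences.
From mathcomp Require Import ring lra zify.
From mathcomp Require summability.

Set Implicit Arguments.
Unset Strict Implicit.
Unset Printing Implicit Defensive.

Import Order.TTheory GRing.Theory Num.Theory.
Import numFieldNormedType.Exports.

Local Open Scope classical_set_scope.
Local Open Scope complex_scope.
Local Open Scope ring_scope.

(** Partial sums of the formal power series of [T] need not be bounded in norm, which is why Cesaro
    means enter. The compressions to windows of degrees replace the integral against a Fejer kernel
    by a finite count. A single Q_p T Q_p is in general not in the algebra; after averaging, the
    entry of [T] between two degrees carries a weight depending only on their difference, and this
    makes the mean a polynomial in the B_i. Windows cut off at degree 0 are included, so that every
    degree lies in equally many of them; the squared norms of the Q_p x then add up to N times that
    of x, whence the norm bound. That bound also dominates the series of every trace functional, so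
    convergence of matrix entries becomes w*-convergence. The y^(k) stay unnormalised: the B_i shift
    them without weights, and the weights sit in their norms. *)

(** * Sesquilinearity, Pythagoras and Cauchy-Schwarz *)

Section inner_product.
Variables (R : realType) (H : preHilbertType R).
Implicit Types (x y z : H) (a : R[i]).

Lemma innerDl x y z : inner (x + y) z = inner x z + inner y z.
Proof. by rewrite -[x in LHS]scale1r innerPl mul1r. Qed.

Lemma inner0l z : inner 0 z = 0.
Proof. by apply: (addrI (inner 0 z)); rewrite -innerDl !addr0. Qed.

Lemma innerZl a x z : inner (a *: x) z = a * inner x z.
Proof. by rewrite -[a *: x]addr0 innerPl inner0l addr0. Qed.

Lemma innerNl x z : inner (- x) z = - inner x z.
Proof. by rewrite -scaleN1r innerZl mulN1r. Qed.

Lemma innerBl x y z : inner (x - y) z = inner x z - inner y z.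
Proof. by rewrite innerDl innerNl. Qed.

Lemma innerDr x y z : inner z (x + y) = inner z x + inner z y.
Proof. by rewrite inner_conj innerDl rmorphD/= -!inner_conj. Qed.

Lemma inner0r z : inner z 0 = 0.
Proof. by rewrite inner_conj inner0l rmorph0. Qed.

Lemma innerZr a x z : inner z (a *: x) = a^* * inner z x.
Proof. by rewrite inner_conj innerZl rmorphM/= -inner_conj. Qed.

Lemma innerNr x z : inner z (- x) = - inner z x.
Proof. by rewrite inner_conj innerNl rmorphN/= -inner_conj. Qed.

Lemma innerBr x y z : inner z (x - y) = inner z x - inner z y.
Proof. by rewrite innerDr innerNr. Qed.

Lemma inner_suml (I : Type) (s : seq I) (P : pred I) (F : I -> H) z :
  inner (\sum_(i <- s | P i) F i) z = \sum_(i <- s | P i) inner (F i) z.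
Proof.
apply: (big_morph (fun x => inner x z)) => [x y|]; first exact: innerDl.
exact: inner0l.
Qed.

Lemma inner_sumr (I : Type) (s : seq I) (P : pred I) (F : I -> H) z :
  inner z (\sum_(i <- s | P i) F i) = \sum_(i <- s | P i) inner z (F i).
Proof.
apply: (big_morph (fun x => inner z x)) => [x y|]; first exact: innerDr.
exact: inner0r.
Qed.

Lemma innerxx_eq0 x : (inner x x == 0) = (x == 0).
Proof. by rewrite innerxx sqrf_eq0 normr_eq0. Qed.

Lemma pythagoras x y : inner x y = 0 -> `|x + y| ^+ 2 = `|x| ^+ 2 + `|y| ^+ 2.
Proof.
move=> xy; have yx : inner y x = 0 by rewrite inner_conj xy rmorph0.
by rewrite -!innerxx innerDl !innerDr xy yx addr0 add0r.
Qed.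

Lemma parallelogram x y :
  `|x + y| ^+ 2 + `|x - y| ^+ 2 = 2 * `|x| ^+ 2 + 2 * `|y| ^+ 2.
Proof. by rewrite -!innerxx !innerBl !innerBr !innerDl !innerDr; ring. Qed.

Lemma cauchy_schwarz x y : `|inner x y| <= `|x| * `|y|.
Proof.
rewrite -ler_sqr ?nnegrE ?mulr_ge0// exprMn.
have [->|y0] := eqVneq y 0.
  by rewrite inner0r !normr0 expr0n mulr0 lexx.
have ygt0 : 0 < `|y| ^+ 2 by rewrite exprn_gt0// normr_gt0.
have : 0 <= `|(`|y| ^+ 2) *: x - inner x y *: y| ^+ 2 by rewrite exprn_ge0.
rewrite -innerxx.
have yR : (`|y| ^+ 2)^* = `|y| ^+ 2 by apply/CrealP; rewrite rpredX// normr_real.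
have -> : inner (`|y| ^+ 2 *: x - inner x y *: y)
                (`|y| ^+ 2 *: x - inner x y *: y) =
    `|y| ^+ 2 * (`|x| ^+ 2 * `|y| ^+ 2 - `|inner x y| ^+ 2).
  rewrite normCK innerBl !innerBr !innerZl !innerZr yR -inner_conj -!innerxx.
  ring.
by rewrite pmulr_rge0// subr_ge0.
Qed.

End inner_product.

Lemma cvg_scaleD (R : realType) (a : R[i]) (u v : nat -> R[i]) (l m : R[i]) :
  u @ \oo --> l -> v @ \oo --> m ->
  (fun N => a * u N + v N) @ \oo --> a * l + m.
Proof.
move=> ul vm.
apply: (@cvgD R[i] R[i] nat \oo _ (fun N => a * u N) v); last exact: vm.
apply: (@cvgM R[i] nat \oo _ (fun=> a) u); last exact: ul.
exact: cvg_cst.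
Qed.

(** * Closed subspaces cut out by bounded functionals *)

Section bounded_functionals.
Variables (R : realType) (H : hilbertType R).

(** The uniform bound carries a null limit from nearby points [z] over to [x]. Weak convergence of a
    bounded sequence of operators thus needs testing on a total set only. *)
Lemma null_limit_closed_subspace (f : nat -> H -> R[i]) (K : R) :
  (forall N a x y, f N (a *: x + y) = a * f N x + f N y) ->
  (forall N x, `|f N x| <= K%:C * `|x|) ->
  closed_subspace [set x | f N x @[N --> \oo] --> (0 : R[i])].
Proof.
move=> flin fK.
have f0 N : f N 0 = 0.
  by apply/eqP; rewrite -normr_le0; apply: le_trans (fK _ _) _; rewrite normr0 mulr0.
have fD N x y : f N (x + y) = f N x + f N y.
  by rewrite -[x in LHS]scale1r flin mul1r.
split=> [|a x y /= fx fy|] /=.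
- by under eq_cvg do rewrite f0; exact: cvg_cst.
- under eq_cvg do rewrite flin.
  by have := cvg_scaleD (a := a) fx fy; rewrite mulr0 addr0.
- rewrite closure_id; apply/seteqP; split; first exact: subset_closure.
  move=> x xcl /=; apply/(@cvgrPdist_lt _ R[i]) => e e0.
  pose L : R[i] := (`|K| + 1)%:C.
  have KL : K%:C <= L by rewrite lecR; apply: le_trans (ler_norm _) _; rewrite lerDl.
  have L0 : 0 < L by rewrite ltcR ltr_wpDl.
  have d0 : 0 < e / 2 / L by rewrite !divr_gt0.
  have [z [/= /cvgrPdist_lt fz]] := xcl _ (nbhsx_ballx x _ d0).
  rewrite -ball_normE/= => xz.
  have e20 : 0 < e / 2 by rewrite divr_gt0.
  have := fz _ e20; apply: filterS => N; rewrite !sub0r !normrN => fNz.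
  rewrite -[x](subrK z) fD (splitr e).
  apply: le_lt_trans (ler_normD _ _) _; apply: ltr_leD; last exact: ltW.
  apply: le_lt_trans (fK _ _) _; apply: (@le_lt_trans _ _ (L * `|x - z|)).
    by rewrite ler_wpM2r.
  by rewrite mulrC -ltr_pdivlMr.
Qed.

Lemma kernel_closed_subspace (f : H -> R[i]) (K : R) :
  (forall a x y, f (a *: x + y) = a * f x + f y) ->
  (forall x, `|f x| <= K%:C * `|x|) ->
  closed_subspace [set x | f x = 0].
Proof.
move=> flin fK.
have -> : [set x | f x = 0] = [set x | f x @[_ --> \oo] --> (0 : R[i])].
  apply/seteqP; split=> x /= => [->|]; first exact: cvg_cst.
  have fx : f x @[_ --> \oo] --> f x by apply: cvg_cst.
  by move/(cvg_unique _ fx) => ->.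
by apply: (@null_limit_closed_subspace (fun=> f) K).
Qed.

Lemma inner_kernel_closed_subspace (z : H) :
  closed_subspace [set x : H | inner x z = 0].
Proof.
apply: (@kernel_closed_subspace _ (complex.Re `|z|)) => [a x y|x].
  exact: innerPl.
by rewrite RRe_real ?normr_real// mulrC; exact: cauchy_schwarz.
Qed.

End bounded_functionals.

Lemma normr_Re (R : realType) (V : normedModType R[i]) (x : V) :
  `|x| = (complex.Re `|x|)%:C.
Proof. by rewrite RRe_real ?normr_real. Qed.

Lemma Re_normr_ge0 (R : realType) (V : normedModType R[i]) (x : V) :
  0 <= complex.Re `|x|.
Proof. by rewrite -lecR -normr_Re normr_ge0. Qed.

Lemma gt0_complexP (R : realType) (e : R[i]) : 0 < e -> exists2 r : R, 0 < r & e = r%:C.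
Proof.
by case: e => r s; rewrite ltcE/= => /andP[/eqP -> r0]; exists r.
Qed.

(** * Orthogonal projection onto a closed subspace *)

Section projection.
Variables (R : realType) (H : hilbertType R) (M : closedSubspace H).
Implicit Types (x : H) (y m : csub M).

Let D x m : R := complex.Re `|x - csub_val m| ^+ 2.

Let DE x m : (D x m)%:C = `|x - csub_val m| ^+ 2.
Proof. by rewrite /D rmorphXn/= -normr_Re. Qed.

Let S x := [set D x m | m in [set: csub M]].

Let S_has_inf x : has_inf (S x).
Proof.
split; first by exists (D x 0), 0.
by exists 0 => _ [m _ <-]; rewrite /D sqr_ge0.
Qed.

Let d x := inf (S x).

Let dP x m : (d x)%:C <= `|x - csub_val m| ^+ 2.
Proof. by rewrite -DE lecR; apply: (ge_inf (S_has_inf x).2); exists m. Qed.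

(** Moving [m] by [c *: y], where [c *: w] is the projection of [u] on [w], lowers the squared
    distance by |<u, w>|^2 / |w|^2, yet never below the infimum. Near-minimizers are therefore
    nearly orthogonal to [M]. *)
Let inner_defect x m y :
  `|inner (x - csub_val m) (csub_val y)| ^+ 2 <=
    (`|x - csub_val m| ^+ 2 - (d x)%:C) * `|csub_val y| ^+ 2.
Proof.
set u := x - csub_val m; set w := csub_val y.
have [->|w0] := eqVneq w 0; first by rewrite inner0r !normr0 expr0n mulr0 lexx.
have n0 : `|w| ^+ 2 != 0 by rewrite sqrf_eq0 normr_eq0.
pose c := inner u w / `|w| ^+ 2.
have orth : inner (u - c *: w) w = 0.
  by rewrite innerBl innerZl innerxx divfK// subrr.
have := dP x (m + c *: y).
have -> : x - csub_val (m + c *: y) = u - c *: w.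
  by rewrite [csub_val _]/= opprD addrA.
move=> dle.
have orth' : inner (u - c *: w) (c *: w) = 0 by rewrite innerZr orth mulr0.
have := pythagoras orth'; rewrite subrK => ->.
rewrite normrZ exprMn.
have -> : `|inner u w| ^+ 2 = `|c| ^+ 2 * `|w| ^+ 2 * `|w| ^+ 2.
  rewrite -[inner u w](divfK n0) -/c normrM exprMn -mulrA; congr (_ * _).
  by rewrite normrX normr_id expr2.
by rewrite ler_wpM2r ?exprn_ge0// addrAC lerDr subr_ge0.
Qed.

(** Parallelogram law at the midpoint, which lies in [M] and so has squared distance at least [d x];
    this makes minimizing sequences Cauchy. *)
Let minimizing_gap x m m' :
  `|csub_val m - csub_val m'| ^+ 2 <=
    2 * (`|x - csub_val m| ^+ 2 - (d x)%:C) + 2 * (`|x - csub_val m'| ^+ 2 - (d x)%:C).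
Proof.
have := parallelogram (x - csub_val m') (x - csub_val m).
have -> : x - csub_val m' - (x - csub_val m) = csub_val m - csub_val m'.
  by rewrite opprB addrC addrA subrK.
have -> : x - csub_val m' + (x - csub_val m) =
    2 *: (x - csub_val (2^-1 *: (m + m'))).
  rewrite [csub_val _]/= scalerBr scalerA divff// scale1r scaler_nat mulr2n.
  by rewrite addrACA -opprD [csub_val m' + _]addrC.
rewrite normrZ exprMn normr_nat => E.
have {E} -> : `|csub_val m - csub_val m'| ^+ 2 = 2 * `|x - csub_val m'| ^+ 2 +
    2 * `|x - csub_val m| ^+ 2 - 2 ^+ 2 * `|x - csub_val (2^-1 *: (m + m'))| ^+ 2.
  by rewrite -E addrAC subrr add0r.
set a := `|x - csub_val m'| ^+ 2; set b := `|x - csub_val m| ^+ 2.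
have -> : 2 * (b - (d x)%:C) + 2 * (a - (d x)%:C) = 2 * a + 2 * b - 2 ^+ 2 * (d x)%:C.
  by ring.
by rewrite lerD2l lerN2 ler_wpM2l// exprn_ge0.
Qed.

(** Orthogonality passes from a minimizing sequence to its limit through [inner_defect], without
    showing that the limit attains the infimum. *)
Lemma orth_proj_exists x :
  exists p : csub M, forall y, inner (x - csub_val p) (csub_val y) = 0.
Proof.
have ex j : exists m, D x m < d x + j.+1%:R^-1.
  have j0 : 0 < j.+1%:R^-1 :> R by rewrite invr_gt0 ltr0Sn.
  by have [_ [m _ <-] mj] := inf_adherent j0 (S_has_inf x); exists m.
have [m mP] := choice ex.
have mPC j : `|x - csub_val (m j)| ^+ 2 - (d x)%:C <= (j.+1%:R^-1)%:C.
  by rewrite -DE -rmorphB lecR lerBlDl ltW.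
(* The 4 is the 2 + 2 of [minimizing_gap]. *)
have harm (e : R) : 0 < e -> \forall j \near \oo,
    forall c : R, 0 <= c -> c ^+ 2 <= 4 * j.+1%:R^-1 -> c < e.
  move=> e0; have e20 : 0 < e ^+ 2 / 4 by rewrite divr_gt0 ?exprn_gt0.
  near=> j => c c0 cj.
  rewrite -(@ltr_pXn2r _ 2)// ?nnegrE ?(ltW e0)//.
  apply: le_lt_trans cj _; rewrite mulrC -ltr_pdivlMr//.
  near: j; exact: near_infty_natSinv_lt (PosNum e20).
have mc : cauchy (m @ \oo).
  apply/cauchy_ballP => _ /gt0_complexP[e e0 ->].
  have [N _ NP] := harm _ e0.
  pose A := [set m j | j in [set j | (N <= j)%N]].
  have FA : (m @ \oo) A by exists N => // j /= Nj; exists j.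
  exists (A, A) => // -[_ _] /= [[j Nj <-] [k Nk <-]].
  rewrite -ball_normE/= csub_normE normr_Re ltcR.
  apply: (NP N (leqnn N)); first exact: Re_normr_ge0.
  rewrite -lecR rmorphXn/= -normr_Re; apply: le_trans (minimizing_gap x _ _) _.
  have h k' : (N <= k')%N -> `|x - csub_val (m k')| ^+ 2 - (d x)%:C <= (N.+1%:R^-1)%:C.
    move=> Nk'; apply: le_trans (mPC _) _; rewrite lecR lef_pV2 ?posrE ?ltr0Sn//.
    by rewrite ler_nat ltnS.
  apply: le_trans (lerD (ler_wpM2l _ (h _ Nj)) (ler_wpM2l _ (h _ Nk))) _ => //.
  by rewrite -mulrDl -natrD rmorphM/= rmorph_nat.
have /(@cvgrPdist_lt _ (csub M)) mp : m @ \oo --> lim (m @ \oo) by exact: cauchy_cvg mc.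
set p := lim _ in mp.
exists p => y; apply/eqP; rewrite -normr_le0; apply/ler_addgt0Pr => _ /gt0_complexP[e e0 ->].
rewrite add0r.
have e20 : 0 < e / 2 by rewrite divr_gt0.
pose Y : R := complex.Re `|csub_val y| + 1.
have Y0 : 0 < Y by rewrite ltr_wpDl// Re_normr_ge0.
have eY0 : 0 < e / 2 / Y by rewrite divr_gt0.
have eY0C : 0 < (e / 2 / Y)%:C by rewrite ltcR.
have yY : `|csub_val y| <= Y%:C by rewrite normr_Re lecR lerDl.
have [j [mj hj]] :=
  @filter_ex _ \oo _ _ (@filterI _ \oo _ _ _ (mp _ eY0C) (harm _ eY0)).
have -> : x - csub_val p = (x - csub_val (m j)) - (csub_val p - csub_val (m j)).
  by rewrite opprB addrA subrK.
rewrite innerBl; apply: le_trans (ler_normB _ _) _.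
rewrite [e]splitr rmorphD/= lerD//.
  rewrite -ler_sqr ?nnegrE//; last by rewrite lecR ltW.
  apply: le_trans (inner_defect _ _ _) _.
  apply: (@le_trans _ _ ((j.+1%:R^-1)%:C * Y%:C ^+ 2)).
    apply: ler_pM; rewrite ?exprn_ge0// ?subr_ge0//.
    by rewrite ler_sqr// nnegrE// lecR ltW.
  have : Num.sqrt (j.+1%:R^-1) < e / 2 / Y.
    apply: hj; first exact: sqrtr_ge0.
    have j0 : 0 <= j.+1%:R^-1 :> R by rewrite invr_ge0.
    by rewrite sqr_sqrtr// ler_peMl// ler1n.
  move=> sj; rewrite -!rmorphXn -rmorphM/= lecR.
  rewrite -[X in X * _](@sqr_sqrtr _ (j.+1%:R^-1)) ?invr_ge0// -exprMn.
  rewrite lerXn2r ?nnegrE ?mulr_ge0 ?sqrtr_ge0 ?(ltW Y0) ?(ltW e20) ?(ltW e0)//.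
  by rewrite -ler_pdivlMr// ltW.
apply: le_trans (cauchy_schwarz _ _) _.
move: mj; rewrite csub_normE [csub_val (p - _)]/= => mj.
apply: le_trans (ler_pM _ _ (ltW mj) yY) _ => //.
by rewrite -rmorphM/= divfK ?gt_eqF.
Unshelve. all: by end_near. Qed.

Lemma orth_projP x y : inner (x - csub_val (orth_proj M x)) (csub_val y) = 0.
Proof.
exact: (xgetPex 0 (P := [set p : csub M |
  forall y : csub M, inner (x - csub_val p) (csub_val y) = 0]) (orth_proj_exists x)).
Qed.

Lemma orth_proj_unique x (p : csub M) :
  (forall y, inner (x - csub_val p) (csub_val y) = 0) -> orth_proj M x = p.
Proof.
move=> pP; apply/eqP; rewrite -subr_eq0 -innerxx_eq0; apply/eqP.
set q := orth_proj M x - p.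
have E : csub_val q = (x - csub_val p) - (x - csub_val (orth_proj M x)).
  by rewrite opprB [RHS]addrC addrA subrK.
by rewrite -[inner q q]/(inner (csub_val q) (csub_val q)) {1}E innerBl pP orth_projP subrr.
Qed.

Lemma inner_orth_proj x y : inner (orth_proj M x) y = inner x (csub_val y).
Proof.
by have /eqP := orth_projP x y; rewrite innerBl subr_eq0 eq_sym => /eqP.
Qed.

Lemma linear_orth_proj (a : R[i]) (x y : H) :
  orth_proj M (a *: x + y) = a *: orth_proj M x + orth_proj M y.
Proof.
apply: orth_proj_unique => z; rewrite [csub_val _]/= opprD addrACA -scalerBr.
by rewrite innerDl innerZl !orth_projP mulr0 addr0.
Qed.

Lemma norm_orth_proj x : `|orth_proj M x| <= `|x|.
Proof.
rewrite csub_normE -ler_sqr ?nnegrE//.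
have := orth_projP x (orth_proj M x) => /pythagoras; rewrite subrK => ->.
by rewrite lerDr exprn_ge0.
Qed.

End projection.

(** The residual of [x] after projection on [M] is orthogonal to [S], hence zero. *)
Lemma closed_subspace_total (R : realType) (H : hilbertType R) (S M : set H) :
  (forall x, (forall s, S s -> inner x s = 0) -> x = 0) ->
  closed_subspace M -> S `<=` M -> forall x, M x.
Proof.
move=> S0 Mcl SM x; pose M' := ClosedSubspace Mcl.
have /eqP : x - csub_val (orth_proj M' x) = 0.
  apply: S0 => s /SM Ms; have sM : s \in csub_pred M' by exact/asboolP.
  exact: (orth_projP x (CSub sM)).
by rewrite subr_eq0 => /eqP ->; exact/asboolP/(valP (orth_proj M' x)).
Qed.

Lemma normr_realC (R : realType) (a : R[i]) : exists r : R, `|a| = r%:C.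
Proof. by exists (Normc.normc a); exact: normr_normc. Qed.

(** * Bounded operators and vector functionals *)

Section bounded_operators.
Variables (R : realType) (H : hilbertType R).
Implicit Types (S T : H -> H) (x y z : H) (U : set (H -> H)).

Lemma bounded_operatorD T x y : bounded_operator T -> T (x + y) = T x + T y.
Proof. by move=> [Tlin _]; rewrite -[x in LHS]scale1r Tlin scale1r. Qed.

Lemma bounded_operator0 T : bounded_operator T -> T 0 = 0.
Proof.
by move=> Tb; apply: (addrI (T 0)); rewrite -bounded_operatorD// !addr0.
Qed.

Lemma bounded_operatorZ T (a : R[i]) x :
  bounded_operator T -> T (a *: x) = a *: T x.
Proof.
by move=> Tb; have [Tlin _] := Tb; rewrite -[a *: x]addr0 Tlin bounded_operator0// addr0.
Qed.

Lemma bounded_operatorB T x y : bounded_operator T -> T (x - y) = T x - T y.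
Proof.
by move=> Tb; rewrite bounded_operatorD// -scaleN1r bounded_operatorZ// scaleN1r.
Qed.

Lemma bounded_operator_sum T (I : Type) (s : seq I) (P : pred I) (F : I -> H) :
  bounded_operator T ->
  T (\sum_(i <- s | P i) F i) = \sum_(i <- s | P i) T (F i).
Proof.
move=> Tb; apply: (big_morph T) => [x y|]; first exact: bounded_operatorD.
exact: bounded_operator0.
Qed.

Lemma bounded_operator_gt0 T : bounded_operator T ->
  exists2 K : R, 0 < K & forall x, `|T x| <= K%:C * `|x|.
Proof.
move=> [_ [K TK]]; exists (`|K| + 1) => [|x]; first by rewrite ltr_wpDl.
apply: le_trans (TK x) _; rewrite ler_wpM2r// lecR.
by apply: le_trans (ler_norm _) _; rewrite lerDl.
Qed.

Lemma bounded_operator_id : bounded_operator (idfun : H -> H).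
Proof. by split=> //; exists 1 => x; rewrite mul1r. Qed.

Lemma bounded_operator_comp S T :
  bounded_operator S -> bounded_operator T -> bounded_operator (S \o T).
Proof.
move=> Sb Tb; have [Slin _] := Sb; have [Tlin _] := Tb.
split; first by move=> a x y /=; rewrite Tlin Slin.
have [K K0 SK] := bounded_operator_gt0 Sb.
have [L L0 TL] := bounded_operator_gt0 Tb.
exists (K * L) => x /=; apply: le_trans (SK _) _.
by rewrite rmorphM/= -mulrA ler_wpM2l// lecR ltW.
Qed.

Lemma bounded_operator_scaleD (a : R[i]) S T :
  bounded_operator S -> bounded_operator T ->
  bounded_operator (fun x => a *: S x + T x).
Proof.
move=> [Slin [K SK]] [Tlin [L TL]]; split.
  move=> b x y; rewrite Slin Tlin !scalerDr !scalerA mulrC addrACA.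
  by rewrite [b * a]mulrC.
have [r ar] := normr_realC a.
exists (r * K + L) => x; rewrite rmorphD rmorphM/= mulrDl -ar.
apply: le_trans (ler_normD _ _) _; apply: lerD (TL x).
by rewrite normrZ -mulrA ler_wpM2l.
Qed.

Lemma unital_subalgebra_bounded : unital_subalgebra (@bounded_operator R H).
Proof.
split=> //; first exact: bounded_operator_id.
  by move=> a S T; exact: bounded_operator_scaleD.
exact: bounded_operator_comp.
Qed.

Lemma wstar_closed_bounded : wstar_closed (@bounded_operator R H).
Proof. by split. Qed.

Lemma inner_bounded_le T (K : R) x z : (forall x, `|T x| <= K%:C * `|x|) ->
  `|inner (T x) z| <= (K * complex.Re `|z|)%:C * `|x|.
Proof.
move=> TK; apply: le_trans (cauchy_schwarz _ _) _.
by rewrite rmorphM/= -normr_Re mulrAC ler_wpM2r.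
Qed.

(** Both sides are bounded functionals of [x], so such an identity needs checking on a total set
    only. *)
Lemma inner_eq_closed_subspace T z (c : R[i]) w : bounded_operator T ->
  closed_subspace [set x | inner (T x) z = c * inner x w].
Proof.
move=> Tb; have [Tlin [K TK]] := Tb.
have -> : [set x | inner (T x) z = c * inner x w] =
    [set x | inner (T x) z - c * inner x w = 0].
  by apply/seteqP; split=> x /= /eqP; [rewrite -subr_eq0|rewrite subr_eq0] => /eqP.
have [r cr] := normr_realC c.
apply: (@kernel_closed_subspace _ _ _
    (K * complex.Re `|z| + r * complex.Re `|w|)) => [a x y|x].
  by rewrite Tlin !innerPl; ring.
apply: le_trans (ler_normB _ _) _; rewrite rmorphD/= mulrDl lerD//.
  exact: inner_bounded_le.
rewrite normrM rmorphM/= -cr -normr_Re -mulrA ler_wpM2l// mulrC.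
exact: cauchy_schwarz.
Qed.

(** Zero padding turns the vector functional T |-> <T x, z> into a trace functional, so that
    w*-closed sets can be tested on it. *)
Definition single_vector x : nat -> H := fun k => if k is 0%N then x else 0.

Lemma cvg_series_head (V : normedModType R[i]) (u : nat -> V) :
  (forall k, u k.+1 = 0) -> series u @ \oo --> u 0%N.
Proof.
move=> u0; rewrite -cvg_shiftS.
rewrite [X in X @ _ --> _](_ : _ = fun=> u 0%N); first exact: cvg_cst.
by apply/funext => j; rewrite /series/= big_nat_recl//= big1 ?addr0.
Qed.

Lemma norm_square_summable_single x : norm_square_summable (single_vector x).
Proof.
apply/cvg_ex; exists (`|x| ^+ 2).
apply: (@cvg_series_head R[i] (fun k => `|single_vector x k| ^+ 2)) => k.
by rewrite normr0 expr0n.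
Qed.

Lemma trace_functional_single T x z : bounded_operator T ->
  trace_functional (single_vector x) (single_vector z) T = inner (T x) z.
Proof.
move=> Tb; apply/cvg_lim => //.
apply: (@cvg_series_head R[i]
  (fun k => inner (T (single_vector x k)) (single_vector z k))) => k.
by rewrite inner0r.
Qed.

End bounded_operators.

(** * Generated w*-algebras and their Alg Lat *)

Section generated_algebra.
Variables (R : realType) (H : hilbertType R).
Implicit Types (S T : H -> H) (x y z v : H) (G U : set (H -> H)).

Lemma generated_algebra_bounded G : G `<=` @bounded_operator R H ->
  wstar_algebra_generated G `<=` @bounded_operator R H.
Proof.
move=> Gb; apply: smallest_sub => //.
by split; [exact: unital_subalgebra_bounded|exact: wstar_closed_bounded].
Qed.

(** The bounded operators preserving the kernel of <., v> form a unital algebra containing [G]. It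
    is w*-closed, since S |-> <S x, v> is a trace functional and its vanishing survives
    approximation; the generated algebra lies inside. *)
Lemma generated_algebra_kernel_invariant G v :
  G `<=` @bounded_operator R H ->
  (forall S, G S -> forall x, inner x v = 0 -> inner (S x) v = 0) ->
  forall S, wstar_algebra_generated G S ->
  forall x, inner x v = 0 -> inner (S x) v = 0.
Proof.
move=> Gb Gv.
pose U := [set S : H -> H | bounded_operator S /\
  forall x, inner x v = 0 -> inner (S x) v = 0].
suff GU : wstar_algebra_generated G `<=` U by move=> S /GU[].
apply: smallest_sub; last by move=> S GS; split; [exact: Gb|exact: Gv].
split.
  split=> [S []//||a S T [Sb Sv] [Tb Tv]|S T [Sb Sv] [Tb Tv]].
  - by split=> //; exact: bounded_operator_id.
  - split; first exact: bounded_operator_scaleD.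
    by move=> x xv; rewrite innerPl Sv// Tv// mulr0 addr0.
  - split; first exact: bounded_operator_comp.
    by move=> x xv /=; rewrite Sv// Tv.
split=> [S []//|T Tb TU].
split=> // x xv; apply/eqP; rewrite -normr_le0.
apply/ler_addgt0Pr => _ /gt0_complexP[e e0 ->]; rewrite add0r.
have sv : forall j : H, norm_square_summable (single_vector j).
  by move=> j; exact: norm_square_summable_single.
have [S [Sb Sv]] := TU 1%N (fun=> single_vector x) (fun=> single_vector v) e
  (fun=> sv x) (fun=> sv v) e0.
by move=> /(_ ord0); rewrite !trace_functional_single// Sv// sub0r normrN => /ltW.
Qed.

(* The kernel of an eigenfunctional is invariant for the whole algebra, hence
   for [T], so the functional [inner (T _) v] is a multiple of [inner _ v]. *)
Lemma AlgLat_eigenfunctional G v e T :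
  G `<=` @bounded_operator R H ->
  (forall S, G S -> exists c : R[i], forall x, inner (S x) v = c * inner x v) ->
  inner e v = 1 -> Alg (Lat (wstar_algebra_generated G)) T ->
  forall x, inner (T x) v = inner (T e) v * inner x v.
Proof.
move=> Gb Gv ev [Tb TL] x.
have inv := generated_algebra_kernel_invariant Gb (v := v).
have [] := TL [set x | inner x v = 0].
  split; first exact: inner_kernel_closed_subspace.
  move=> S AS _ [z zv <-] /=; apply: inv AS _ zv => S' GS' w wv.
  by have [c ->] := Gv _ GS'; rewrite wv mulr0.
move=> _ /(_ T erefl) TM.
have : inner (x - inner x v *: e) v = 0.
  by rewrite innerBl innerZl ev mulr1 subrr.
move=> h; have /eqP : inner (T (x - inner x v *: e)) v = 0.
  by apply: TM; exists (x - inner x v *: e).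
rewrite bounded_operatorB// bounded_operatorZ// innerBl innerZl subr_eq0.
by move=> /eqP ->; rewrite mulrC.
Qed.

(** Paired with any [v] of [V], both [S] and [T] act as scalars, and scalars commute. *)
Lemma AlgLat_commutes G (V : set H) e T :
  G `<=` @bounded_operator R H ->
  (forall v, V v -> inner e v = 1 /\ forall S, G S ->
    exists c : R[i], forall x, inner (S x) v = c * inner x v) ->
  (forall u, (forall v, V v -> inner u v = 0) -> u = 0) ->
  Alg (Lat (wstar_algebra_generated G)) T ->
  forall S, G S -> forall x, T (S x) = S (T x).
Proof.
move=> Gb GV V0 TA S GS x; apply/eqP; rewrite -subr_eq0; apply/eqP/V0 => v Vv.
have [ev Gv] := GV v Vv; have [c Sc] := Gv S GS.
have := AlgLat_eigenfunctional Gb Gv ev TA; set t := inner (T e) v => Tv.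
by rewrite innerBl Tv !Sc Tv mulrCA subrr.
Qed.

(** One inclusion is formal. The other is membership in an intersection, so [T] has to be placed in
    every admissible [U]. *)
Lemma reflexive_generatedP G :
  G `<=` @bounded_operator R H ->
  (forall T U, Alg (Lat (wstar_algebra_generated G)) T ->
    unital_subalgebra U -> wstar_closed U -> G `<=` U -> U T) ->
  reflexive_algebra (wstar_algebra_generated G).
Proof.
move=> Gb GT; apply/seteqP; split=> [S AS|T TA U [[Ualg Uw] GU]].
  split; first exact: generated_algebra_bounded AS.
  by move=> M [Mcl MA]; split=> // _ ->; exact: MA.
exact: GT.
Qed.

End generated_algebra.

(** * Dominated convergence of series, and w*-limits of bounded sequences *)

Section dominated_series.
Variable R : realType.

Lemma ler_norm_sum_dominated (a g : nat -> R[i]) (m k : nat) :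
  (forall i, `|a i| <= g i) ->
  `|\sum_(m <= i < k) a i| <= `|\sum_(m <= i < k) g i|.
Proof.
move=> ag; apply: le_trans (ler_norm_sum _ _ _) _.
have g0 i : 0 <= g i by apply: le_trans (ag i).
by rewrite [leRHS]ger0_norm ?sumr_ge0//; apply: ler_sum.
Qed.

Lemma dominated_series_cvg (a g : nat -> R[i]) :
  cvgn (series g) -> (forall k, `|a k| <= g k) -> cvgn (series a).
Proof.
move=> /cvg_cauchy/cauchy_seriesP gc ag.
apply: (@cauchy_cvg R[i]); apply/cauchy_seriesP => e e0.
apply: filterS (gc e e0) => -[m k]/=; apply: le_lt_trans.
exact: ler_norm_sum_dominated.
Qed.

Lemma dominated_series_tail (g : nat -> R[i]) (e : R) :
  cvgn (series g) -> 0 < e ->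
  exists m, forall k, (m <= k)%N -> `|\sum_(m <= i < k) g i| < e%:C.
Proof.
move=> /cvg_cauchy/cauchy_seriesP gc e0; have e0C : 0 < e%:C by rewrite ltcR.
have [[A B] [/= [m1 _ mA] [m2 _ mB]] AB] := gc _ e0C.
exists (maxn m1 m2) => k mk; apply: (AB (maxn m1 m2, k)); split => /=.
  by apply: mA; exact: leq_maxl.
by apply: mB; apply: leq_trans mk; exact: leq_maxr.
Qed.

Lemma cvg_sum_nat (a : nat -> nat -> R[i]) (b : nat -> R[i]) m :
  (forall k, a N k @[N --> \oo] --> b k) ->
  \sum_(0 <= k < m) a N k @[N --> \oo] --> \sum_(0 <= k < m) b k.
Proof.
move=> ab; elim: m => [|m IH].
  rewrite big_nil; rewrite [X in X @ _ --> _](_ : _ = fun=> 0); first exact: cvg_cst.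
  by apply/funext => N; rewrite big_nil.
have E (u : nat -> R[i]) : \sum_(0 <= k < m.+1) u k = 1 * \sum_(0 <= k < m) u k + u m.
  by rewrite mul1r (big_nat_recr _ _ _ (leq0n m)).
rewrite E (_ : (fun N => _) = fun N => 1 * (\sum_(0 <= k < m) a N k) + a N m).
  exact: (@cvg_scaleD R 1 (fun N => \sum_(0 <= k < m) a N k) (a^~ m) _ _ IH (ab m)).
by apply/funext => N; rewrite E.
Qed.

Lemma dominated_series_limit (a : nat -> nat -> R[i]) (b g : nat -> R[i]) :
  cvgn (series g) -> (forall N k, `|a N k| <= g k) -> (forall k, `|b k| <= g k) ->
  (forall k, a N k @[N --> \oo] --> b k) ->
  limn (series (a N)) @[N --> \oo] --> limn (series b).
Proof.
move=> gc ag bg ab; apply/(@cvgrPdist_lt _ R[i]) => _ /gt0_complexP[e e0 ->].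
(* Two parts for each of the tails of [b] and [a N], one for the difference of the first [m] terms.
   A tail costs two because its limit is first replaced by a partial sum up to [j]. *)
have e5 : 0 < e / 5 by rewrite divr_gt0.
have e5C : 0 < (e / 5)%:C by rewrite ltcR.
have [m mg] := dominated_series_tail gc e5.
have /(@cvgrPdist_lt _ R[i])/(_ _ e5C) := cvg_sum_nat (m := m) ab.
apply: filterS => N Nab.
have tail (u : nat -> R[i]) : (forall k, `|u k| <= g k) ->
    `|limn (series u) - \sum_(0 <= k < m) u k| < (e / 5 + e / 5)%:C.
  move=> ug; have uc : series u @ \oo --> limn (series u).
    exact: dominated_series_cvg gc ug.
  move/(@cvgrPdist_lt _ R[i]) : uc => /(_ _ e5C)[k _ kP].
  pose j := maxn k m.
  have mj : (m <= j)%N by exact: leq_maxr.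
  have := kP j (leq_maxl _ _).
  rewrite /= /series/= (big_cat_nat (leq0n m) mj)//= => uj.
  rewrite -[limn _](subrK (\sum_(0 <= i < m) u i + \sum_(m <= i < j) u i)).
  rewrite -[X in `|X|]addrA [X in _ + X]addrAC subrr add0r rmorphD/=.
  apply: le_lt_trans (ler_normD _ _) _; apply: ltr_leD => //.
  apply: le_trans (ltW (mg _ mj)).
  exact: ler_norm_sum_dominated.
have -> : limn (series b) - limn (series (a N)) =
    (limn (series b) - \sum_(0 <= k < m) b k) +
    (\sum_(0 <= k < m) b k - \sum_(0 <= k < m) a N k) -
    (limn (series (a N)) - \sum_(0 <= k < m) a N k) by ring.
have -> : e%:C = (e / 5 + e / 5)%:C + (e / 5)%:C + (e / 5 + e / 5)%:C.
  by rewrite -!rmorphD; congr (_%:C); lra.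
apply: le_lt_trans (ler_normB _ _) _; apply: ltrD (tail _ (ag N)).
by apply: le_lt_trans (ler_normD _ _) _; apply: ltrD (tail _ bg) _.
Qed.

End dominated_series.

Section weak_convergence.
Variables (R : realType) (H : hilbertType R).
Variables (S : nat -> H -> H) (T : H -> H) (K : R).
Hypothesis SK : forall N x, `|S N x| <= K%:C * `|x|.
Hypothesis TK : forall x, `|T x| <= K%:C * `|x|.
Hypothesis K0 : 0 <= K.

(** The bound K (|x_k|^2 + |z_k|^2) on the terms is summable and independent of [N], so termwise
    convergence suffices. *)
Lemma trace_functional_cvg (x z : nat -> H) :
  norm_square_summable x -> norm_square_summable z ->
  (forall u w, inner (S N u) w @[N --> \oo] --> inner (T u) w) ->
  trace_functional x z (S N) @[N --> \oo] --> trace_functional x z T.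
Proof.
move=> xs zs ST.
pose g k : R[i] := K%:C * (`|x k| ^+ 2 + `|z k| ^+ 2).
have K0C : 0 <= K%:C by rewrite lecR.
have bound (A : H -> H) : (forall u, `|A u| <= K%:C * `|u|) ->
    forall k, `|inner (A (x k)) (z k)| <= g k.
  move=> AK k; apply: le_trans (cauchy_schwarz _ _) _.
  apply: le_trans (ler_wpM2r _ (AK _)) _ => //; rewrite -mulrA ler_wpM2l//.
  rewrite (normr_Re (x k)) (normr_Re (z k)) -!rmorphXn -rmorphD -rmorphM lecR/=.
  set p := complex.Re _; set q := complex.Re _.
  have := sqr_ge0 (p - q); have := mulr_ge0 (Re_normr_ge0 (x k)) (Re_normr_ge0 (z k)).
  by rewrite -/p -/q !expr2 => h1 h2; lra.
apply: (@dominated_series_limit R _ _ g).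
- pose sx := series (fun k => `|x k| ^+ 2); pose sz := series (fun k => `|z k| ^+ 2).
  have -> : series g = fun m => K%:C * (1 * sx m + sz m) + 0.
    apply/funext => m; rewrite /sx /sz /series/= addr0 mul1r -big_split/=.
    by rewrite mulr_sumr.
  apply/cvg_ex; exists (K%:C * (1 * limn sx + limn sz) + 0).
  apply: (@cvg_scaleD R _ (fun m => 1 * sx m + sz m) (fun=> 0)).
    exact: (@cvg_scaleD R 1 sx sz (limn sx) (limn sz) xs zs).
  exact: cvg_cst.
- by move=> N; apply: bound.
- exact: bound.
- by move=> k; exact: ST.
Qed.

(** For norm-bounded sequences, weak operator convergence implies w*-convergence. A basic
    neighbourhood involves finitely many functionals, so one [S N] serves them all. *)
Lemma wstar_closed_cvg (U : set (H -> H)) : wstar_closed U ->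
  (forall N, U (S N)) -> bounded_operator T ->
  (forall u w, inner (S N u) w @[N --> \oo] --> inner (T u) w) -> U T.
Proof.
move=> [_ Uw] US Tb ST; apply: Uw => // m x z e xs zs e0.
have e0C : 0 < e%:C by rewrite ltcR.
have : \forall N \near \oo, forall j, `|trace_functional (x j) (z j) (S N) -
    trace_functional (x j) (z j) T| < e%:C.
  apply: filter_forall => j.
  have /(@cvgrPdist_lt _ R[i])/(_ _ e0C) := trace_functional_cvg (xs j) (zs j) ST.
  by apply: filterS => N; rewrite distrC.
by move=> [N _ /(_ N (leqnn N))]; exists (S N).
Qed.

End weak_convergence.

(** * Multi-indices, windows of degrees and finite combinations *)

Definition grade n (k : 'I_n -> nat) : nat := (\sum_i k i)%N.

Definition addk n (k l : 'I_n -> nat) : 'I_n -> nat := fun i => (k i + l i)%N.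

Definition unitk n (i : 'I_n) : 'I_n -> nat := fun j => nat_of_bool (j == i).

Lemma grade_addk n (k l : 'I_n -> nat) : grade (addk k l) = (grade k + grade l)%N.
Proof. exact: big_split. Qed.

Lemma sum_interval (L a b : nat) : (b < L)%N ->
  (\sum_(p < L) ((a < p) && (p <= b)) = b - a)%N.
Proof.
move=> bL; rewrite -(subnK bL); elim: (L - b.+1)%N => [|m IH].
  rewrite add0n; elim: b {bL} => [|b IH].
    by rewrite big_ord_recr big_ord0.
  rewrite big_ord_recr/= leqnn andbT.
  rewrite (eq_bigr (fun p : 'I_b.+1 => nat_of_bool ((a < p) && (p <= b)))%N).
    by rewrite IH; case: (ltnP a b.+1) => ab; lia.
  by move=> p _; have := ltn_ord p; rewrite ltnS => pb; rewrite pb (leq_trans pb).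
rewrite addSn big_ord_recr/= IH (_ : (m + b.+1 <= b)%N = false) ?andbF ?addn0//.
by apply/negbTE; rewrite -ltnNge leq_addl.
Qed.

Definition in_window N (p g : nat) := ((g < p) && (p <= g + N.+1))%N.

(* The Fejer weight [N.+1 - (h - g)] counts the windows containing both
   grades. *)
Lemma sum_windows N L g h : (g <= h)%N -> (h + N.+1 < L)%N ->
  (\sum_(p < L) in_window N p g * in_window N p h = N.+1 - (h - g))%N.
Proof.
move=> gh hL; have gL : (g + N.+1 < L)%N by lia.
have -> : (N.+1 - (h - g) = g + N.+1 - h)%N by lia.
rewrite -(sum_interval _ gL); apply: eq_bigr => p _.
by rewrite /in_window; lia.
Qed.

Section combinations.
Variables (R : realType) (H : hilbertType R) (n : nat).
Variable y : ('I_n -> nat) -> H.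
Implicit Types (s : seq (('I_n -> nat) * R[i])) (A : H -> H).

Definition comb s : H := \sum_(j <- s) j.2 *: y j.1.

(** The projection Q_p, realised on finite combinations by filtering the list of terms. *)
Definition window N p s := [seq j <- s | in_window N p (grade j.1)].

Lemma comb_cons a k s : comb ((k, a) :: s) = a *: y k + comb s.
Proof. by rewrite /comb big_cons. Qed.

Lemma comb_cat s t : comb (s ++ t) = comb s + comb t.
Proof. by rewrite /comb big_cat. Qed.

Lemma comb_scale (a : R[i]) s : comb [seq (j.1, a * j.2) | j <- s] = a *: comb s.
Proof.
rewrite /comb big_map scaler_sumr; apply: eq_bigr => j _; by rewrite scalerA.
Qed.

Lemma inner_comb A s t : bounded_operator A ->
  inner (A (comb s)) (comb t) =
  \sum_(j <- s) \sum_(j' <- t) j.2 * j'.2^* * inner (A (y j.1)) (y j'.1).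
Proof.
move=> Ab; rewrite bounded_operator_sum// inner_suml; apply: eq_bigr => j _.
rewrite inner_sumr; apply: eq_bigr => j' _.
by rewrite bounded_operatorZ// innerZl innerZr mulrA.
Qed.

(** After interchanging the sums, a pair of terms is counted once for each window containing both
    grades. *)
Lemma sum_inner_windows A N L s t : bounded_operator A ->
  \sum_(p < L) inner (A (comb (window N p s))) (comb (window N p t)) =
  \sum_(j <- s) \sum_(j' <- t) j.2 * j'.2^* *
    ((\sum_(p < L) in_window N p (grade j.1) * in_window N p (grade j'.1))%N%:R *
      inner (A (y j.1)) (y j'.1)).
Proof.
move=> Ab; under eq_bigr do rewrite inner_comb//.
under eq_bigr => p _.
  rewrite big_filter big_mkcond/=.
  under eq_bigr => j _ do rewrite big_filter big_mkcond/=.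
  over.
rewrite exchange_big/=; apply: eq_bigr => j _.
rewrite (eq_bigr (fun p : 'I_L => \sum_(j' <- t)
  j.2 * j'.2^* * ((in_window N p (grade j.1) * in_window N p (grade j'.1))%N%:R *
    inner (A (y j.1)) (y j'.1)))); last first.
  move=> p _; case: ifP => _; last by rewrite big1// => j' _; rewrite mul0n mul0r mulr0.
  by apply: eq_bigr => j' _; case: ifP => _; rewrite ?mul1r ?muln0 ?mul0r ?mulr0.
rewrite exchange_big/=; apply: eq_bigr => j' _.
by rewrite natr_sum mulr_suml mulr_sumr.
Qed.

Lemma comb_dense : (forall M, closed_subspace M -> (forall k, M (y k)) -> forall x, M x) ->
  forall x (e : R), 0 < e -> exists s, `|x - comb s| < e%:C.
Proof.
move=> tot; apply: (tot [set x | forall e : R, 0 < e -> exists s, `|x - comb s| < e%:C]).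
  split=> [e e0|a x z xs zs e e0|].
  - by exists [::]; rewrite /comb big_nil subrr normr0 ltcR.
  - have [r ar] := normr_realC a.
    have r0 : 0 <= r by rewrite -lecR -ar normr_ge0.
    have e20 : 0 < e / 2 by rewrite divr_gt0.
    have er0 : 0 < e / 2 / (r + 1) by rewrite divr_gt0// ltr_wpDl.
    have [s xs'] := xs _ er0; have [t zt] := zs _ e20.
    exists ([seq (j.1, a * j.2) | j <- s] ++ t).
    rewrite comb_cat comb_scale opprD addrACA -scalerBr.
    rewrite (splitr e) rmorphD/=; apply: le_lt_trans (ler_normD _ _) _.
    apply: ler_ltD zt; rewrite normrZ ar.
    apply: le_trans (ler_wpM2l _ (ltW xs')) _; first by rewrite lecR.
    rewrite -rmorphM/= lecR mulrA ler_pdivrMr ?ltr_wpDl//.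
    by rewrite mulrC ler_wpM2l ?(ltW e20)// lerDl.
  - rewrite closure_id; apply/seteqP; split; first exact: subset_closure.
    move=> x xcl e e0; have e20 : 0 < e / 2 by rewrite divr_gt0.
    have e20C : 0 < (e / 2)%:C by rewrite ltcR.
    have [z [/= /(_ _ e20)[s zs]]] := xcl _ (nbhsx_ballx x _ e20C).
    rewrite -ball_normE/= => xz; exists s.
    rewrite -[x](subrK z) -addrA (splitr e) rmorphD/=.
    by apply: le_lt_trans (ler_normD _ _) _; apply: ltrD.
move=> k e e0; exists [:: (k, 1)].
by rewrite comb_cons /comb big_nil addr0 scale1r subrr normr0 ltcR.
Qed.

End combinations.

(** * Cesaro means of an operator commuting with the shifts *)

Section cesaro_means.
Variables (R : realType) (H : hilbertType R) (n : nat).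
Variables (y : ('I_n -> nat) -> H) (B : 'I_n -> H -> H) (T : H -> H).
Hypothesis y_orth : forall k l, k <> l -> inner (y k) (y l) = 0.
Hypothesis y_neq0 : forall k, y k != 0.
Hypothesis y_total :
  forall M, closed_subspace M -> (forall k, M (y k)) -> forall x, M x.
Hypothesis Bb : forall i, bounded_operator (B i).
Hypothesis By : forall i k, B i (y k) = y (addk (unitk i) k).
Hypothesis Tb : bounded_operator T.
Hypothesis TB : forall i x, T (B i x) = B i (T x).

Definition mpow (k : 'I_n -> nat) (x : H) : H :=
  foldr (fun i => iter (k i) (B i)) x (enum 'I_n).

Lemma mpow_ind (U : set (H -> H)) k : U idfun ->
  (forall i A, U A -> U (B i \o A)) -> U (mpow k).
Proof.
move=> U1 UB; rewrite /mpow; elim: (enum 'I_n) => [|i s IH]//=.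
by elim: (k i) => [|m IHm] //=; exact: UB.
Qed.

Lemma bounded_mpow k : bounded_operator (mpow k).
Proof.
apply: mpow_ind => [|i A]; first exact: bounded_operator_id.
exact: bounded_operator_comp.
Qed.

Lemma mpow_commutes k x : T (mpow k x) = mpow k (T x).
Proof.
rewrite /mpow; elim: (enum 'I_n) => [|i s IH]//=.
by elim: (k i) => [|m IHm] //=; rewrite TB IHm.
Qed.

Lemma mpow_y k l : mpow k (y l) = y (addk k l).
Proof.
rewrite /mpow.
(* Prepares an induction over lists: [k] is cut off outside the letters of the list, and uniqueness
   keeps a letter from counting twice. *)
have -> : addk k l = addk (fun i => if i \in enum 'I_n then k i else 0%N) l.
  by apply/funext => i; rewrite /addk mem_enum.
elim: (enum 'I_n) (enum_uniq 'I_n) => [_|i s IH /= /andP[iNs us]].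
  by congr y; apply/funext => i; rewrite /addk in_nil.
rewrite IH//; set l' := addk _ l.
have -> m : iter m (B i) (y l') = y (addk (fun j => if j == i then m else 0)%N l').
  elim: m => [|m IHm] /=.
    by congr y; apply/funext => j; rewrite /addk; case: ifP.
  rewrite IHm By; congr y; apply/funext => j; rewrite /addk /unitk.
  by case: (j == i); lia.
congr y; apply/funext => j; rewrite /addk /l' /addk in_cons.
by have [->|ji] := eqVneq j i; rewrite ?(negPf iNs) ?add0n.
Qed.

Definition leqk (l m : 'I_n -> nat) := [forall i, (l i <= m i)%N].
Definition subk (m l : 'I_n -> nat) : 'I_n -> nat := fun i => (m i - l i)%N.

Lemma addk_subk l m : leqk l m -> addk (subk m l) l = m.
Proof. by move=> /forallP lm; apply/funext => i; rewrite /addk /subk subnK. Qed.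

Lemma leqk_addk k l : leqk l (addk k l).
Proof. by apply/forallP => i; rewrite leq_addl. Qed.

Lemma addkK k l : subk (addk k l) l = k.
Proof. by apply/funext => i; rewrite /addk /subk addnK. Qed.

(** The adjoint of [mpow l] sends [y m] to a multiple of [y (subk m l)], or to 0. The quotient of
    squared norms appears because the [y] are not normalised. *)
Lemma inner_mpow l m x : inner (mpow l x) (y m) =
  (if leqk l m then inner (y m) (y m) / inner (y (subk m l)) (y (subk m l)) else 0) *
  inner x (y (subk m l)).
Proof.
apply: (y_total (inner_eq_closed_subspace (y m) _ (y (subk m l)) (bounded_mpow l))) => k /=.
rewrite mpow_y; have [lm|lm] := boolP (leqk l m); last first.
  rewrite mul0r y_orth// => e; move: lm; rewrite -e => /negP; apply; apply/forallP => i.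
  exact: leq_addr.
have [->|kml] := pselect (k = subk m l).
  rewrite divfK ?innerxx_eq0//; congr (inner (y _) _); rewrite -[RHS](addk_subk lm).
  by apply/funext => i; rewrite /addk addnC.
rewrite [inner (y k) _]y_orth// mulr0 y_orth// => e; apply: kml.
by rewrite -e; apply/funext => i; rewrite /addk /subk addnC addnK.
Qed.

(** The coefficient of [y d] in the orthogonal expansion of T y^(0), hence of B^d in the formal
    power series of [T]. *)
Definition symbol_coef d : R[i] := inner (T (y (fun=> 0%N))) (y d) / inner (y d) (y d).

(** Commutation makes [T (y l)] the monomial B^l applied to T y^(0). The matrix of [T] is thus of
    analytic Toeplitz type, up to the norms of the [y]. *)
Lemma inner_symbol l m : inner (T (y l)) (y m) =
  if leqk l m then symbol_coef (subk m l) * inner (y m) (y m) else 0.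
Proof.
have -> : y l = mpow l (y (fun=> 0%N)).
  by rewrite mpow_y; congr y; apply/funext => i; rewrite /addk addn0.
rewrite mpow_commutes inner_mpow; case: ifP => _; last by rewrite mul0r.
by rewrite /symbol_coef [LHS]mulrAC [RHS]mulrAC; congr (_ / _); rewrite mulrC.
Qed.

(** The index runs over a box containing all exponents of degree at most [N]; truncated subtraction
    gives weight 0 to every higher degree. *)
Definition cesaro_mean N (x : H) : H :=
  \sum_(k : {ffun 'I_n -> 'I_N.+1})
    ((N.+1 - grade (fun i => k i))%:R / N.+1%:R * symbol_coef (fun i => k i)) *:
    mpow (fun i => k i) x.

Lemma unital_subalgebra_sum (U : set (H -> H)) (I : Type) (s : seq I)
    (a : I -> R[i]) (A : I -> H -> H) :
  unital_subalgebra U -> (forall i, U (A i)) ->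
  U (fun x => \sum_(i <- s) a i *: A i x).
Proof.
move=> [_ U1 Ulin _] UA; elim: s => [|i s IH].
  have -> : (fun x => \sum_(i <- [::]) a i *: A i x) = fun x => (-1) *: idfun x + idfun x.
    by apply/funext => x; rewrite big_nil scaleN1r addNr.
  exact: Ulin.
have -> : (fun x => \sum_(j <- i :: s) a j *: A j x) =
    fun x => a i *: A i x + \sum_(j <- s) a j *: A j x.
  by apply/funext => x; rewrite big_cons.
exact: Ulin.
Qed.

Lemma cesaro_mean_in (U : set (H -> H)) N :
  unital_subalgebra U -> (forall i, U (B i)) -> U (cesaro_mean N).
Proof.
move=> Ualg UB; apply: unital_subalgebra_sum => // k.
have [_ U1 _ Ucomp] := Ualg.
by apply: mpow_ind => // i A UA; exact: Ucomp.
Qed.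

Lemma bounded_cesaro_mean N : bounded_operator (cesaro_mean N).
Proof. exact: (cesaro_mean_in _ (unital_subalgebra_bounded _)). Qed.

Lemma leq_grade k i : (k i <= @grade n k)%N.
Proof. by rewrite /grade (bigD1 i)//= leq_addr. Qed.

Lemma grade_subk l m : leqk l m -> grade (subk m l) = (grade m - grade l)%N.
Proof. by move=> /addk_subk {2}<-; rewrite grade_addk addnK. Qed.

Lemma leqk_grade l m : leqk l m -> (grade l <= grade m)%N.
Proof. by move=> /addk_subk <-; rewrite grade_addk leq_addl. Qed.

(** Only the exponent m - l can contribute. If its degree is at most [N] it lies in the box,
    otherwise the weight is 0; the mean is therefore an entrywise Fejer multiplier. *)
Lemma inner_cesaro_mean N l m : inner (cesaro_mean N (y l)) (y m) =
  (N.+1 - (grade m - grade l))%:R / N.+1%:R * inner (T (y l)) (y m).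
Proof.
rewrite inner_suml inner_symbol.
under eq_bigr do rewrite innerZl mpow_y.
have [lm|lm] := boolP (leqk l m); last first.
  rewrite mulr0 big1// => k _; rewrite y_orth ?mulr0// => e.
  by move: lm; rewrite -e leqk_addk.
rewrite -grade_subk//; set d := subk m l.
have zero (k : {ffun 'I_n -> 'I_N.+1}) : (fun i => k i : nat) <> d ->
    (N.+1 - grade (fun i => k i))%:R / N.+1%:R * symbol_coef (fun i => k i) *
      inner (y (addk (fun i => k i) l)) (y m) = 0.
  move=> kd; rewrite y_orth ?mulr0// => e; apply: kd.
  by rewrite /d -e addkK.
have [dN|Nd] := ltnP (grade d) N.+1; last first.
  rewrite (_ : N.+1 - grade d = 0)%N ?mul0r; last by apply/eqP; rewrite subn_eq0.
  apply: big1 => k _; have [e|] := pselect ((fun i => k i : nat) = d); last exact: zero.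
  rewrite (_ : N.+1 - _ = 0)%N ?mul0r//; apply/eqP; rewrite subn_eq0.
  by rewrite e.
have kP i : (d i < N.+1)%N by apply: leq_ltn_trans dN; exact: leq_grade.
pose k0 : {ffun 'I_n -> 'I_N.+1} := [ffun i => Ordinal (kP i)].
have k0d : (fun i => k0 i : nat) = d by apply/funext => i; rewrite ffunE.
rewrite (bigD1 k0)//= k0d addk_subk// big1 ?addr0 ?mulrA// => k kk0.
apply: zero => kd; move/negP : kk0; apply; apply/eqP/ffunP => i.
by apply/val_inj; rewrite ffunE/=; exact: (congr1 (fun f => f i) kd).
Qed.

Lemma norm_AMGM (u v : H) : 2 * (`|u| * `|v|) <= `|u| ^+ 2 + `|v| ^+ 2.
Proof.
rewrite (normr_Re u) (normr_Re v) -!rmorphXn -rmorphM -rmorphD /=.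
have -> : 2 = 2%:C :> R[i] by rewrite rmorph_nat.
rewrite -rmorphM/= lecR; set p := complex.Re _; set q := complex.Re _.
by have := sqr_ge0 (p - q); rewrite !expr2 => h; lra.
Qed.

(** Both identities count windows. For the mean the count is the Fejer weight; for the norms only
    equal indices survive, each counted [N.+1] times. [L] is large enough to include every window
    meeting [s] or [t]. *)
Lemma inner_cesaro_windows N s t : exists L : nat,
  N.+1%:R * inner (cesaro_mean N (comb y s)) (comb y t) =
    \sum_(p < L) inner (T (comb y (window N p s))) (comb y (window N p t)) /\
  (forall u, u \in [:: s; t] -> N.+1%:R * `|comb y u| ^+ 2 =
    \sum_(p < L) `|comb y (window N p u)| ^+ 2).
Proof.
have [L Ls] : exists L : nat, forall j, (j \in s ++ t) -> (grade j.1 + N.+1 < L)%N.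
  (* The sum of all grades stands in for their maximum. *)
  exists (\sum_(j <- s ++ t) grade j.1 + N.+2)%N => j jst.
  have : (grade j.1 <= \sum_(j <- s ++ t) grade j.1)%N by rewrite (big_rem j)//= leq_addr.
  by lia.
have N0 : N.+1%:R != 0 :> R[i] by rewrite pnatr_eq0.
exists L; split.
  rewrite inner_comb; last exact: bounded_cesaro_mean.
  rewrite sum_inner_windows// mulr_sumr; apply: eq_big_seq => j js.
  rewrite mulr_sumr; apply: eq_big_seq => j' j't; rewrite mulrCA; congr (_ * _).
  rewrite inner_cesaro_mean mulrA mulrCA divff// mulr1.
  (* When [leqk] fails, the grades may come in the wrong order for [sum_windows], but the entry of
     [T] vanishes. *)
  have [lm|lm] := boolP (leqk j.1 j'.1).
    rewrite (sum_windows (leqk_grade lm))//; apply: Ls.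
    by rewrite mem_cat j't orbT.
  by rewrite inner_symbol (negPf lm) !mulr0.
move=> u ust.
have usub j : j \in u -> j \in s ++ t.
  by move: ust; rewrite mem_cat !inE => /orP[]/eqP <- ->; rewrite ?orbT.
have idb : bounded_operator (idfun : H -> H) := bounded_operator_id H.
under [RHS]eq_bigr do rewrite -innerxx.
rewrite -innerxx.
rewrite -[inner (comb y u) _]/(inner (idfun (comb y u)) (comb y u)) inner_comb//.
have -> : \sum_(p < L) inner (comb y (window N p u)) (comb y (window N p u)) =
  \sum_(p < L) inner (idfun (comb y (window N p u))) (comb y (window N p u)) by [].
rewrite sum_inner_windows// mulr_sumr; apply: eq_big_seq => j ju.
rewrite mulr_sumr; apply: eq_big_seq => j' j'u; rewrite mulrCA; congr (_ * _).
have [e|jj'] := pselect (j.1 = j'.1).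
  by rewrite e sum_windows ?subnn ?subn0//; apply: Ls; exact: usub.
by rewrite /= y_orth// !mulr0.
Qed.

Variable K : R.
Hypothesis K0 : 0 <= K.
Hypothesis TK : forall x, `|T x| <= K%:C * `|x|.

Let K0C : 0 <= K%:C.
Proof. by rewrite lecR. Qed.

(** Each window contributes at most K |Q_p s| |Q_p t|, and the squares add up to the full norms.
    AM-GM stands in for Cauchy-Schwarz over [p]; its loss is undone by rescaling in
    [norm_cesaro_comb]. *)
Lemma cesaro_comb_sesquilinear_le N s t :
  2 * `|inner (cesaro_mean N (comb y s)) (comb y t)| <=
    K%:C * (`|comb y s| ^+ 2 + `|comb y t| ^+ 2).
Proof.
have [L [LE Lu]] := inner_cesaro_windows N s t.
have N0 : 0 < N.+1%:R :> R[i] by rewrite ltr0Sn.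
rewrite -(ler_pM2l N0) mulrCA -{1}(gtr0_norm N0) -normrM LE [leRHS]mulrCA mulrDr.
rewrite !Lu ?inE ?eqxx ?orbT// -big_split/= mulr_sumr.
apply: le_trans (ler_wpM2l _ (ler_norm_sum _ _ _)) _ => //.
rewrite mulr_sumr; apply: ler_sum => p _.
apply: le_trans (ler_wpM2l K0C (norm_AMGM _ _)).
rewrite [leRHS]mulrCA ler_wpM2l// mulrA.
by apply: le_trans (cauchy_schwarz _ _) _; rewrite ler_wpM2r.
Qed.

(** Allows the mean of a combination to be the second argument of [cesaro_comb_sesquilinear_le]. *)
Lemma cesaro_mean_comb N s : exists t, cesaro_mean N (comb y s) = comb y t.
Proof.
have combD u v : (exists t, u = comb y t) -> (exists t, v = comb y t) ->
    exists t, u + v = comb y t.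
  by move=> [t ->] [t' ->]; exists (t ++ t'); rewrite comb_cat.
have combZ (a : R[i]) u : (exists t, u = comb y t) -> exists t, a *: u = comb y t.
  by move=> [t ->]; exists [seq (j.1, a * j.2) | j <- t]; rewrite comb_scale.
have comb0 : exists t, 0 = comb y t by exists [::]; rewrite /comb big_nil.
have -> : cesaro_mean N (comb y s) = \sum_(j <- s) j.2 *: cesaro_mean N (y j.1).
  rewrite bounded_operator_sum; last exact: bounded_cesaro_mean.
  by apply: eq_bigr => j _; rewrite bounded_operatorZ//; exact: bounded_cesaro_mean.
apply: (big_ind (fun u => exists t, u = comb y t)) => // j _; apply: (combZ).
apply: (big_ind (fun u => exists t, u = comb y t)) => // k _; apply: (combZ).
rewrite mpow_y; exists [:: (addk (fun i => k i) j.1, 1)].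
by rewrite comb_cons /comb big_nil addr0 scale1r.
Qed.

Lemma norm_cesaro_comb N s : `|cesaro_mean N (comb y s)| <= K%:C * `|comb y s|.
Proof.
have Sb := bounded_cesaro_mean N.
set x := comb y s; have [t xt] := cesaro_mean_comb N s; rewrite -/x in xt.
set U := `|cesaro_mean N x|; set X := `|x|.
have [U0|U0] := eqVneq U 0; first by rewrite U0 mulr_ge0 ?normr_ge0.
have [X0|X0] := eqVneq X 0.
  by move/eqP: U0; rewrite /U (normr0_eq0 X0) bounded_operator0// normr0.
have Ugt0 : 0 < U by rewrite lt_def U0 normr_ge0.
have Xgt0 : 0 < X by rewrite lt_def X0 normr_ge0.
(* Both combinations are rescaled to the norm [U * X], where AM-GM is an equality. *)
have := cesaro_comb_sesquilinear_le N
  [seq (j.1, U * j.2) | j <- s] [seq (j.1, X * j.2) | j <- t].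
rewrite !comb_scale -/x -xt bounded_operatorZ// innerZl innerZr innerxx -/U.
rewrite !(normrZ, normrM, norm_conjC, normrX, normr_id) -/U -/X.
have -> : K%:C * ((U * X) ^+ 2 + (X * U) ^+ 2) = 2 * (U * X * U * (K%:C * X)) by ring.
have -> : 2 * (U * (X * U ^+ 2)) = 2 * (U * X * U * U) by ring.
by rewrite ler_pM2l// ler_pM2l// !mulr_gt0.
Qed.

Lemma norm_cesaro_mean N x : `|cesaro_mean N x| <= K%:C * `|x|.
Proof.
(* The bound [C] may depend on [N], but it only multiplies the approximation error. *)
have Sb := bounded_cesaro_mean N; have [C C0 SC] := bounded_operator_gt0 Sb.
apply/ler_addgt0Pr => _ /gt0_complexP[e e0 ->].
have KC : 0 < K + C by rewrite ltr_wpDl.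
have eK : 0 < e / (K + C) by rewrite divr_gt0.
have [s xs] := comb_dense y_total x eK.
rewrite -{1}(subrK (comb y s) x) bounded_operatorD//.
apply: le_trans (ler_normD _ _) _.
apply: le_trans (lerD (SC _) (norm_cesaro_comb _ _)) _.
have xs' : `|comb y s| <= `|x| + `|x - comb y s|.
  by rewrite -{1}(subKr x (comb y s)); exact: ler_normB.
apply: le_trans (lerD (lexx _) (ler_wpM2l K0C xs')) _.
rewrite mulrDr addrCA lerD2l -mulrDl addrC.
rewrite -rmorphD/=; apply: le_trans (ler_wpM2l _ (ltW xs)) _; first by rewrite lecR ltW.
by rewrite -rmorphM/= mulrC divfK// gt_eqF.
Qed.

Lemma cesaro_mean_cvg_basis l m :
  inner (cesaro_mean N (y l)) (y m) @[N --> \oo] --> inner (T (y l)) (y m).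
Proof.
apply/(@cvgrPdist_lt _ R[i]) => _ /gt0_complexP[e e0 ->].
set t := inner (T (y l)) (y m); set d := (grade m - grade l)%N.
have [r tr] := normr_realC t.
have r0 : 0 <= r by rewrite -lecR -tr normr_ge0.
have q0 : 0 < e / (d%:R * r + 1) by rewrite divr_gt0// ltr_wpDl// mulr_ge0.
apply: filterS (near_infty_natSinv_lt (PosNum q0)) => N /= Ne.
rewrite inner_cesaro_mean -/t -/d.
have N0 : N.+1%:R != 0 :> R[i] by rewrite pnatr_eq0.
(* The Fejer weight falls short of 1 by min(d, N+1) / (N+1), at most d / (N+1). *)
have -> : t - (N.+1 - d)%:R / N.+1%:R * t = (minn d N.+1)%:R / N.+1%:R * t.
  rewrite -{1}[t]mul1r -mulrBl; congr (_ * _).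
  rewrite -{1}(divff N0) -mulrBl; congr (_ / _); rewrite -natrB ?leq_subr//.
  by congr (_%:R); lia.
rewrite normrM tr normrM normfV !normr_nat.
apply: (@le_lt_trans _ _ (d%:R / N.+1%:R * r%:C)).
  rewrite ler_wpM2r ?lecR// ler_wpM2r ?invr_ge0// ler_nat.
  exact: geq_minl.
have -> : d%:R / N.+1%:R * r%:C = (d%:R * r / N.+1%:R)%:C.
  by rewrite !rmorphM/= fmorphV !rmorph_nat mulrAC.
rewrite ltcR; apply: (@le_lt_trans _ _ ((d%:R * r + 1) / N.+1%:R)).
  by rewrite ler_wpM2r ?invr_ge0// lerDl.
by rewrite mulrC -ltr_pdivlMr// ltr_wpDl// mulr_ge0.
Qed.

(** The differences [D N] are uniformly bounded, so convergence extends from the [y] to all vectors,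
    in the second argument and then in the first. *)
Lemma cesaro_mean_cvg x z :
  inner (cesaro_mean N x) z @[N --> \oo] --> inner (T x) z.
Proof.
pose D N u := cesaro_mean N u - T u.
have Dlin N (a : R[i]) u v : D N (a *: u + v) = a *: D N u + D N v.
  have Sb := bounded_cesaro_mean N.
  rewrite /D (bounded_operatorD _ _ Sb) (bounded_operatorZ _ _ Sb).
  rewrite (bounded_operatorD _ _ Tb) (bounded_operatorZ _ _ Tb).
  by rewrite scalerBr opprD addrACA.
have DK N u : `|D N u| <= (K + K)%:C * `|u|.
  apply: le_trans (ler_normB _ _) _; rewrite rmorphD/= mulrDl lerD//.
  exact: norm_cesaro_mean.
have null (u w : H) : inner (D N u) w @[N --> \oo] --> (0 : R[i]) ->
    inner (cesaro_mean N u) w @[N --> \oo] --> inner (T u) w.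
  move=> /(@cvgrPdist_lt _ R[i]) h; apply/(@cvgrPdist_lt _ R[i]) => e /h.
  by apply: filterS => N; rewrite sub0r normrN innerBl distrC.
(* [null_limit_closed_subspace] wants linearity in the varying vector, while the second slot of
   [inner] is conjugate-linear. *)
have swap (u w : H) : inner (D N u) w @[N --> \oo] --> (0 : R[i]) <->
    inner w (D N u) @[N --> \oo] --> (0 : R[i]).
  split=> /(@cvgrPdist_lt _ R[i]) h; apply/(@cvgrPdist_lt _ R[i]) => e /h;
  by apply: filterS => N; rewrite !sub0r !normrN inner_conj norm_conjC.
have basis l w : inner (D N (y l)) w @[N --> \oo] --> (0 : R[i]).
  apply/swap; move: w.
  apply: y_total.
    apply: (@null_limit_closed_subspace _ _ (fun N w => inner w (D N (y l)))
      ((K + K) * complex.Re `|y l|)) => N *; first exact: innerPl.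
    rewrite mulrC; apply: le_trans (cauchy_schwarz _ _) _; rewrite ler_wpM2l//.
    by rewrite rmorphM/= -normr_Re; exact: DK.
  move=> m; apply/swap/(@cvgrPdist_lt _ R[i]) => e e0.
  have /(@cvgrPdist_lt _ R[i])/(_ e e0) := @cesaro_mean_cvg_basis l m.
  by apply: filterS => N; rewrite sub0r normrN innerBl distrC.
apply: null; move: x; apply: y_total => [|k]; last exact: basis.
apply: (@null_limit_closed_subspace _ _ (fun N u => inner (D N u) z)
  ((K + K) * complex.Re `|z|)) => N *; first by rewrite Dlin innerPl.
exact: inner_bounded_le.
Qed.

End cesaro_means.

(** * Reflexivity for shifts of an orthogonal system in a Hilbert space *)

(** The elements of [V] are joint eigenvectors of the adjoints of the [B i], with the conjugate of
    [c] as eigenvalue; the relation is asked on the [y] and extends by totality. *)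
Theorem orthogonal_shift_algebra_reflexive (R : realType) (H : hilbertType R)
    (n : nat) (y : ('I_n -> nat) -> H) (B : 'I_n -> H -> H) (V : set H) :
  (forall k l, k <> l -> inner (y k) (y l) = 0) ->
  (forall k, y k != 0) ->
  (forall M, closed_subspace M -> (forall k, M (y k)) -> forall x, M x) ->
  (forall i, bounded_operator (B i)) ->
  (forall i k, B i (y k) = y (addk (unitk i) k)) ->
  (forall v, V v -> inner (y (fun=> 0%N)) v = 1) ->
  (forall v i, V v -> exists c : R[i],
    forall k, inner (y (addk (unitk i) k)) v = c * inner (y k) v) ->
  (forall u, (forall v, V v -> inner u v = 0) -> u = 0) ->
  reflexive_algebra (wstar_algebra_generated (range B)).
Proof.
move=> y_orth y_neq0 y_total Bb By V1 Veig V0.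
have Gb : range B `<=` @bounded_operator R H by move=> _ [i _ <-]; exact: Bb.
apply: reflexive_generatedP => // T U TA Ualg Uw BU.
have Tb : bounded_operator T by case: TA.
have TB i x : T (B i x) = B i (T x).
  apply: (@AlgLat_commutes R H (range B) V (y (fun=> 0%N)) T) => // v Vv.
  split=> [|_ [j _ <-]]; first exact: V1.
  have [c cP] := Veig v j Vv; exists c.
  apply: (y_total _ (inner_eq_closed_subspace v c v (Bb j))) => k /=.
  by rewrite By.
have [K K0 TK] := bounded_operator_gt0 Tb.
have UB i : U (B i) by apply: BU; exists i.
have Kge0 : 0 <= K := ltW K0.
apply: (@wstar_closed_cvg R H (cesaro_mean y B T) T K) => //.
- by move=> N x; exact: norm_cesaro_mean.
- by move=> N; exact: cesaro_mean_in.
- by move=> x z; exact: (cesaro_mean_cvg y_orth y_neq0 y_total Bb By Tb TB Kge0).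
Qed.

(** * Absolutely convergent sums and the identity theorem in one variable *)

Section absolutely_convergent_sums.
Variables (R : realType) (I : choiceType).
Implicit Types (f g c : I -> R[i]) (A F : {fset I}).

Definition abs_bounded f (M : R) :=
  forall A, \sum_(a <- A) Normc.normc (f a) <= M.

Lemma abs_bounded_le f g (M : R) : abs_bounded f M ->
  (forall a, Normc.normc (g a) <= Normc.normc (f a)) -> abs_bounded g M.
Proof. by move=> fM gf A; apply: le_trans (fM A); exact: ler_sum. Qed.

Lemma sum_finite_support f F : (forall a, a \notin F -> f a = 0) ->
  summability.sum f = \sum_(a <- F) f a.
Proof.
move=> fF; have part A : (F `<=` A)%fset -> \sum_(a <- A) f a = \sum_(a <- F) f a.
  move=> FA; rewrite (sum_fsetID _ FA) [X in _ + X]big_seq [X in _ + X]big1 ?addr0//.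
  by move=> a; rewrite in_fsetD => /andP[aF _]; exact: fF.
apply: cvg_lim => //; apply/(@cvgrPdist_lt _ R[i]) => e e0.
by exists F => // A FA; rewrite partial_sumE part// subrr normr0.
Qed.

Lemma norm_sum_le f (M : R) : abs_bounded f M -> `|summability.sum f| <= M%:C.
Proof.
move=> fM; have := cvg_partial_sum fM => /(@cvgrPdist_lt _ R[i]) fs.
apply/ler_addgt0Pr => e e0; have [A _ /(_ A)] := fs e e0.
rewrite partial_sumE => sA.
rewrite -[summability.sum f](subrK (\sum_(a <- A) f a)).
apply: le_trans (ler_normD _ _) _; rewrite addrC lerD//.
  apply: le_trans (ler_norm_sum _ _ _) _.
  apply: (@le_trans _ _ (\sum_(a <- A) Normc.normc (f a))%:C).
    by rewrite rmorph_sum.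
  by rewrite lecR.
by apply: ltW; apply: sA; exact: fsubset_refl.
Qed.

Lemma sum_scaleD (a : R[i]) f g (M N : R) : abs_bounded f M -> abs_bounded g N ->
  summability.sum (fun b => a * f b + g b) =
  a * summability.sum f + summability.sum g.
Proof.
move=> fM gN; apply: cvg_lim => //.
have -> : summability.partial_sum (fun b => a * f b + g b) =
    fun A => a * summability.partial_sum f A + summability.partial_sum g A.
  apply/funext => A; rewrite !partial_sumE mulr_sumr -big_split/=.
  by apply: eq_bigr.
apply: cvgD; last exact: cvg_partial_sum gN.
by apply: cvgM; [exact: cvg_cst|exact: cvg_partial_sum fM].
Qed.

(* With [c a * t ^ d a] as the terms of a power series in [t], the fibre sums
   are its coefficients. *)
Lemma fiber_sum_eq0 c (M : R) (d : I -> nat) : abs_bounded c M ->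
  (forall t : R, 0 < t -> t <= 1 ->
    summability.sum (fun a => (t ^+ d a)%:C * c a) = 0) ->
  forall m, summability.sum (fun a => (d a == m)%:R * c a) = 0.
Proof.
(* [g m t] sums to the power series with its terms of degree below [m] removed, divided by t^m; it
   keeps the bound [M] for 0 < t <= 1. *)
move=> cM c0; pose g m (t : R) a : R[i] := ((m <= d a)%N%:R * t ^+ (d a - m))%:C * c a.
have gM m (t : R) : 0 < t -> t <= 1 -> abs_bounded (g m t) M.
  move=> t0 t1; apply: abs_bounded_le cM _ => a; rewrite /g Normc.normcM.
  rewrite ler_piMl ?normc_ge0//= expr0n addr0 sqrtr_sqr ger0_norm.
    by case: leqP; rewrite ?mul0r// mul1r exprn_ile1// ltW.
  by rewrite mulr_ge0// exprn_ge0// ltW.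
have fM m : abs_bounded (fun a => (d a == m)%:R * c a) M.
  apply: abs_bounded_le cM _ => a; case: eqP => _; rewrite ?mul1r// mul0r.
  by rewrite Normc.normc0 normc_ge0.
have step m : (forall t : R, 0 < t -> t <= 1 -> summability.sum (g m t) = 0) ->
    summability.sum (fun a => (d a == m)%:R * c a) = 0 /\
    forall t : R, 0 < t -> t <= 1 -> summability.sum (g m.+1 t) = 0.
  move=> g0; have E (t : R) : 0 < t -> t <= 1 ->
      t%:C * summability.sum (g m.+1 t) +
      summability.sum (fun a => (d a == m)%:R * c a) = 0.
    move=> t0 t1; rewrite -(sum_scaleD _ (gM m.+1 t t0 t1) (fM m)) -[RHS](g0 t t0 t1).
    congr summability.sum; apply/funext => a; rewrite /g mulrA -mulrDl; congr (_ * _).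
    case: (ltngtP m (d a)) => [md|md|->].
    - by rewrite addr0 !mul1r -rmorphM/= -exprS subnSK.
    - by rewrite !mul0r addr0 mulr0.
    - by rewrite mul0r mulr0 add0r mul1r subnn expr0.
  have F0 : summability.sum (fun a => (d a == m)%:R * c a) = 0.
    apply/eqP; rewrite -normr_le0; apply/ler_addgt0Pr => _ /gt0_complexP[e e0 ->].
    rewrite add0r.
    (* By [E] the coefficient has norm at most t M, which this [t] brings down to [e]. *)
    pose t := Num.min 1 (e / (`|M| + 1)).
    have M0 : 0 < `|M| + 1 by rewrite ltr_wpDl.
    have t0 : 0 < t by rewrite lt_min ltr01 divr_gt0.
    have t1 : t <= 1 by rewrite ge_min lexx.
    have := E t t0 t1; rewrite addrC => /eqP; rewrite addr_eq0 => /eqP ->.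
    rewrite normrN normrM; apply: le_trans (ler_wpM2l _ (norm_sum_le (gM _ _ t0 t1))) _ => //.
    have -> : `|t%:C| = t%:C by rewrite ger0_norm// lecR ltW.
    rewrite -rmorphM lecR.
    apply: (@le_trans _ _ (e / (`|M| + 1) * (`|M| + 1))); last first.
      by rewrite divfK// gt_eqF.
    apply: (@le_trans _ _ (t * (`|M| + 1))).
      by rewrite ler_wpM2l ?(ltW t0)//; apply: le_trans (ler_norm _) _; rewrite lerDl.
    by rewrite ler_wpM2r ?(ltW M0)// ge_min lexx orbT.
  split=> // t t0 t1; have := E t t0 t1; rewrite F0 addr0 => /eqP.
  by rewrite mulf_eq0 => /orP[|/eqP//]; rewrite (inj_eq (@complexI R)) gt_eqF.
have all_g m : forall t : R, 0 < t -> t <= 1 -> summability.sum (g m t) = 0.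
  elim: m => [t t0 t1|m IH]; last exact: (step m IH).2.
  rewrite -(c0 t t0 t1); congr summability.sum; apply/funext => a.
  by rewrite /g leq0n mul1r subn0.
by move=> m; exact: (step m (all_g m)).1.
Qed.

End absolutely_convergent_sums.

(** * Words and their letter counts *)

Section words.
Variables (R : realType) (n : nat).
Implicit Types (a b : word n) (k : 'I_n -> nat).

Definition letter_count a : 'I_n -> nat := fun i => count_mem i a.

Lemma letter_count_cons i a : letter_count (i :: a) = addk (unitk i) (letter_count a).
Proof. by apply/funext => j; rewrite /letter_count /addk /unitk/= eq_sym. Qed.

Lemma word_monomialE (l : 'rV[R[i]]_n) a :
  word_monomial l a = \prod_(i < n) l 0 i ^+ letter_count a i.
Proof.
rewrite /word_monomial; elim: a => [|i a IH].
  by rewrite big_nil big1// => i _; rewrite expr0.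
rewrite big_cons IH letter_count_cons (bigD1 i)//= [RHS](bigD1 i)//= mulrA.
rewrite /addk /unitk eqxx exprS; congr (_ * _); apply: eq_bigr => j /negPf ->.
by rewrite add0n.
Qed.

Lemma LambdaE k : @Lambda R n k = [set a | letter_count a = k].
Proof.
apply/seteqP; split=> a /= => [ak|<- l]; last exact: word_monomialE.
(* With 2 at place [i] and 1 elsewhere, both monomials are powers of 2 that reveal the exponent of
   [i]. *)
apply/funext => i; have := ak (\row_j (if j == i then 2 else 1)).
rewrite word_monomialE (bigD1 i)//= [RHS](bigD1 i)//= !mxE eqxx.
rewrite !big1 ?mulr1 => [|j /negPf ji|j /negPf ji]; rewrite ?mxE ?ji ?expr1n//.
by move/eqP; rewrite -!natrX eqr_nat eqn_exp2l// => /eqP.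
Qed.

Lemma size_letter_count a : size a = grade (letter_count a).
Proof.
elim: a => [|i a IH]; first by rewrite /grade big1.
rewrite letter_count_cons grade_addk -IH /grade (bigD1 i)//= /unitk eqxx.
by rewrite big1// => j /negPf ->.
Qed.

(** All these words have length [grade k]. Finiteness lets the finitary sums in [omega] and
    [sym_vector] be read as genuine sums. *)
Lemma finite_Lambda k : finite_set (@Lambda R n k).
Proof.
rewrite LambdaE; apply: (@sub_finite_set _ _ (range (@tval (grade k) 'I_n))).
  move=> a /= ak; have sa : size a == grade k by rewrite -ak size_letter_count.
  by exists (Tuple sa).
exact: (finite_image _ finite_finset).
Qed.

Lemma Lambda_neq0 k : @Lambda R n k !=set0.
Proof.
rewrite LambdaE; exists (flatten [seq nseq (k i) i | i <- enum 'I_n]) => /=.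
apply/funext => j; rewrite /letter_count count_flatten -map_comp sumnE big_map.
rewrite big_enum/= (bigD1 j)//= count_nseq/= eqxx mul1n big1 ?addn0// => i /negPf ij.
by rewrite count_nseq/= ij.
Qed.

Definition Lambda_fset k : {fset word n} := fset_set (@Lambda R n k).

Lemma in_Lambda_fset k a : (a \in Lambda_fset k) = `[< letter_count a = k >].
Proof.
rewrite in_fset_set; last exact: finite_Lambda.
by rewrite LambdaE; apply/idP/asboolP; rewrite inE.
Qed.

Lemma inner_fock_basis (x : fock R n) a : inner x (fock_basis R a) = x a.
Proof.
rewrite -[inner x _]/(ell2_inner x (fock_basis R a)) /ell2_inner.
rewrite (@sum_finite_support _ _ _ [fset a]%fset) => [|b]; last first.
  rewrite inE => /negPf ba; rewrite /= /fock_basis_fun ba.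
  by rewrite rmorph0 mulr0.
by rewrite big_seq_fset1 /= /fock_basis_fun eqxx rmorph1 mulr1.
Qed.

End words.

(** * Symmetric vectors and the left shifts *)

Section symmetric_fock.
Variables (R : realType) (n : nat) (mu : weight_sequence R n).
Implicit Types (a b : word n) (k m : 'I_n -> nat).

Lemma wprod_gt0 a : 0 < wprod mu a.
Proof. by elim: a => [|i a IH] /=; rewrite ?ltr01// mulr_gt0// weight_gt0. Qed.

Lemma omegaE k : omega mu k = \sum_(a <- Lambda_fset R k) (wprod mu a ^+ 2)^-1.
Proof. by rewrite /omega fsbig_finite//; exact: finite_Lambda. Qed.

Lemma omega_gt0 k : 0 < omega mu k.
Proof.
have [a ak] := Lambda_neq0 R k; rewrite LambdaE/= in ak.
have aF : a \in Lambda_fset R k by rewrite in_Lambda_fset; exact/asboolP.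
rewrite omegaE (big_fsetD1 a)//= ltr_pwDl ?invr_gt0 ?exprn_gt0 ?wprod_gt0//.
by apply: sumr_ge0 => b _; rewrite invr_ge0 exprn_ge0// ltW// wprod_gt0.
Qed.

Lemma sym_vectorE k : sym_vector mu k = (omega mu k)^-1%:C *:
  \sum_(a <- Lambda_fset R k) (wprod mu a)^-1%:C *: fock_basis R a.
Proof. by rewrite /sym_vector fsbig_finite//; exact: finite_Lambda. Qed.

Lemma conj_real_complex (r : R) : (r%:C)^* = r%:C :> R[i].
Proof. exact: conjc_real. Qed.

Lemma inner_sym_vector (x : fock R n) k : inner x (sym_vector mu k) =
  (omega mu k)^-1%:C * \sum_(a <- Lambda_fset R k) (wprod mu a)^-1%:C * x a.
Proof.
rewrite sym_vectorE innerZr conj_real_complex inner_sumr; congr (_ * _).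
by apply: eq_bigr => a _; rewrite innerZr conj_real_complex inner_fock_basis.
Qed.

Lemma sym_vector_coord k a : sym_vector mu k a =
  if `[< letter_count a = k >] then (omega mu k)^-1%:C * (wprod mu a)^-1%:C else 0.
Proof.
rewrite -inner_fock_basis sym_vectorE innerZl inner_suml.
rewrite -(in_Lambda_fset R); case: ifPn => ak.
  congr (_ * _); rewrite (big_fsetD1 a)//= big_seq big1 => [|b].
    by rewrite addr0 innerZl inner_fock_basis /= /fock_basis_fun eqxx mulr1.
  rewrite !inE => /andP[/negPf ba _].
  by rewrite innerZl inner_fock_basis /= /fock_basis_fun eq_sym ba mulr0.
rewrite big_seq big1 ?mulr0// => b bk.
rewrite innerZl inner_fock_basis /= /fock_basis_fun.
case: eqP => [ab|]; last by rewrite mulr0.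
by move: ak; rewrite ab bk.
Qed.

Lemma sum_omega k : \sum_(a <- Lambda_fset R k) (wprod mu a)^-1%:C * (wprod mu a)^-1%:C =
  (omega mu k)%:C.
Proof.
rewrite omegaE rmorph_sum/=; apply: eq_bigr => a _.
by rewrite -rmorphM -invfM.
Qed.

(** Different exponents have disjoint supports; on the diagonal, [sum_omega] cancels one of the two
    normalising factors. *)
Lemma inner_sym_vectors k m : inner (sym_vector mu k) (sym_vector mu m) =
  if `[< k = m >] then (omega mu m)^-1%:C else 0.
Proof.
rewrite inner_sym_vector; case: asboolP => [->|km].
  have -> : \sum_(a <- Lambda_fset R m) (wprod mu a)^-1%:C * sym_vector mu m a =
      (omega mu m)^-1%:C * (omega mu m)%:C.
    rewrite -sum_omega mulr_sumr big_seq [RHS]big_seq; apply: eq_bigr => a am.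
    by rewrite sym_vector_coord -(in_Lambda_fset R) am mulrCA.
  by rewrite -[X in _ * X]rmorphM/= mulVf ?mulr1// gt_eqF// omega_gt0.
rewrite big_seq big1 ?mulr0// => a; rewrite in_Lambda_fset => /asboolP am.
rewrite sym_vector_coord; case: asboolP => [ak|]; last by rewrite mulr0.
by case: km; rewrite -am -ak.
Qed.

Lemma linear_left_shift i (c : R[i]) (x z : fock R n) :
  left_shift mu i (c *: x + z) = c *: left_shift mu i x + left_shift mu i z.
Proof.
apply: val_inj; apply/funext => -[|j a].
  by rewrite -[RHS]/(c * 0 + 0) mulr0 addr0.
rewrite -[RHS]/(c * left_shift_fun mu i x (j :: a) + left_shift_fun mu i z (j :: a)).
rewrite /= ; case: eqP => _; last by rewrite mulr0 addr0.
by rewrite mulrDr mulrCA.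
Qed.

(** The weight [mu (i :: a)] cancels the first factor of [wprod mu (i :: a)], and the remaining sum
    is [omega mu k], which cancels the normalisation of y^(k). The shifted vector, supported on
    words beginning with [i], thus has the same projection as the next symmetric vector. *)
Lemma inner_left_shift_sym_vector i k m :
  inner (left_shift mu i (sym_vector mu k)) (sym_vector mu m) =
  inner (sym_vector mu (addk (unitk i) k)) (sym_vector mu m).
Proof.
have l0 : left_shift mu i 0 = 0.
  apply: (addIr (left_shift mu i 0)); rewrite add0r.
  by have := linear_left_shift i 1 0 0; rewrite !scale1r addr0.
have lZ (c : R[i]) (x : fock R n) : left_shift mu i (c *: x) = c *: left_shift mu i x.
  by have := linear_left_shift i c x 0; rewrite l0 !addr0.
have -> : left_shift mu i (sym_vector mu k) = (omega mu k)^-1%:C *: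
    \sum_(a <- Lambda_fset R k)
      (wprod mu a)^-1%:C *: ((mu (i :: a))%:C *: fock_basis R (i :: a)).
  rewrite sym_vectorE lZ; congr (_ *: _).
  rewrite (big_morph (left_shift mu i) (id1 := 0) (op1 := +%R)) => [|x z|//].
    by apply: eq_bigr => a _; rewrite lZ left_shift_basis.
  by have := linear_left_shift i 1 x z; rewrite !scale1r.
rewrite inner_sym_vectors innerZl inner_suml.
have term a : a \in Lambda_fset R k ->
    inner ((wprod mu a)^-1%:C *: ((mu (i :: a))%:C *: fock_basis R (i :: a)))
      (sym_vector mu m) =
    (if `[< addk (unitk i) k = m >] then (omega mu m)^-1%:C else 0) *
      ((wprod mu a)^-1%:C * (wprod mu a)^-1%:C).
  rewrite in_Lambda_fset => /asboolP ak; rewrite !innerZl inner_conj inner_fock_basis.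
  rewrite sym_vector_coord letter_count_cons ak; case: ifP => _.
    rewrite rmorphM /= !conj_real_complex mulrCA [LHS]mulrCA -!rmorphM; congr (_%:C).
    rewrite invfM; have := wprod_gt0 a; have := weight_gt0 mu (b := i :: a) isT => m0 w0.
    by field; rewrite !gt_eqF// omega_gt0.
  by rewrite rmorph0 !mulr0 mul0r.
rewrite big_seq (eq_bigr _ term) -big_seq -mulr_sumr sum_omega mulrCA -rmorphM/=.
by rewrite mulVf ?mulr1// gt_eqF// omega_gt0.
Qed.

(** Only words beginning with [i] carry nonzero coordinates, and deleting that letter is injective
    on them; the weights are bounded by [K]. *)
Lemma bounded_left_shift i : exists2 K : R, 0 <= K &
  forall x : fock R n, `|left_shift mu i x| <= K%:C * `|x|.
Proof.
have [K0 K0P] := weight_left_bounded mu i; pose K := `|K0|.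
have K_ge0 : 0 <= K by exact: normr_ge0.
exists K => // x; set r := complex.Re `|x|.
have r0 : 0 <= r by exact: Re_normr_ge0.
rewrite (normr_Re x) -/r -rmorphM/=.
have xM : forall A : {fset word n}, \sum_(a <- A) Normc.normc (x a) ^+ 2 <= r ^+ 2.
  by apply/(ell2_norm_leP x r0); rewrite -normr_Re.
apply/ell2_norm_leP => [|A]; first exact: mulr_ge0.
pose B := [fset b in A | ohead b == Some i]%fset.
have BA : (B `<=` A)%fset by apply/fsubsetP => b; rewrite !inE => /andP[].
rewrite (sum_fsetID _ BA) [X in _ + X]big_seq [X in _ + X]big1 ?addr0; last first.
  move=> [|j a]; first by rewrite /= expr0n addr0 sqrtr0 expr0n.
  rewrite !inE/= => /andP[+ jA]; rewrite jA/= => jB.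
  case: (eqVneq j i) jB => [->|_ _]; first by rewrite eqxx.
  by rewrite Normc.normc0 expr0n.
apply: (@le_trans _ _ (\sum_(b <- B) K ^+ 2 * Normc.normc (x (behead b)) ^+ 2)).
  rewrite big_seq [leRHS]big_seq; apply: ler_sum => -[|j a]; rewrite !inE/= ?andbF//.
  move=> /andP[_ /eqP[->]]; rewrite eqxx Normc.normcM exprMn.
  rewrite ler_wpM2r ?sqr_ge0//= expr0n addr0 sqrtr_sqr lerXn2r ?nnegrE//.
  rewrite gtr0_norm ?weight_gt0//; apply: le_trans (ler_norm _).
  by apply: K0P; exists a.
rewrite -mulr_sumr exprMn ler_wpM2l ?sqr_ge0//.
have binj : {in B &, injective (@behead 'I_n)}.
  move=> [|j a] [|l b]; rewrite !inE/= ?andbF//.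
  by move=> /andP[_ /eqP[->]] /andP[_ /eqP[->]] ->.
by have := xM [fset behead b | b in B]%fset; rewrite big_imfset.
Qed.

End symmetric_fock.

(** * Evaluation vectors at points of the convergence domain *)

Section point_evaluations.
Variables (R : realType) (n : nat) (mu : weight_sequence R n).
Implicit Types (a : word n) (k : 'I_n -> nat) (l : 'rV[R[i]]_n).

Lemma eval_vector_subproof l : convergence_domain mu l ->
  (fun a => (word_monomial l a)^* * (wprod mu a)^-1%:C) \in
    square_summable_pred (I := word n).
Proof.
move=> ld; apply/asboolP; rewrite /square_summable.
rewrite (_ : (fun a => _) =
  fun a => (Normc.normc (word_monomial l a) ^+ 2 / wprod mu a ^+ 2)%:E)//.
apply/funext => a; congr (_%:E); rewrite Normc.normcM exprMn; congr (_ * _).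
  by case: (word_monomial l a) => p q /=; rewrite sqrrN.
by rewrite /= expr0n addr0 sqrtr_sqr normfV exprVn real_normK// num_real.
Qed.

(** A reproducing-kernel vector: [l] is in the domain exactly when these coordinates are square
    summable. The conjugate offsets the conjugate-linear second slot, so pairing gives a power
    series in [l]. *)
Definition eval_vector l (ld : convergence_domain mu l) : fock R n :=
  Ell2 (eval_vector_subproof ld).

Definition eval_term (u : fock R n) l a : R[i] :=
  u a * (word_monomial l a * (wprod mu a)^-1%:C).

Lemma eval_term_conj (u : fock R n) l (ld : convergence_domain mu l) a :
  u a * (eval_vector ld a)^* = eval_term u l a.
Proof. by rewrite /eval_term rmorphM/= conjCK conj_real_complex. Qed.

Lemma inner_eval_vector (u : fock R n) l (ld : convergence_domain mu l) :
  inner u (eval_vector ld) = summability.sum (eval_term u l).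
Proof.
rewrite -[LHS]/(ell2_inner u (eval_vector ld)) /ell2_inner.
by congr summability.sum; apply/funext => a; exact: eval_term_conj.
Qed.

Lemma abs_bounded_eval_term (u : fock R n) l : convergence_domain mu l ->
  exists M, abs_bounded (eval_term u l) M.
Proof.
move=> ld; have [M uM] := ell2P u; have [N zN] := ell2P (eval_vector ld).
exists (M + N) => A.
apply: (@le_trans _ _ (\sum_(a <- A) (Normc.normc (u a) ^+ 2 +
    Normc.normc (eval_vector ld a) ^+ 2))).
  by apply: ler_sum => a _; rewrite -(eval_term_conj _ ld); exact: normcM_le.
by rewrite big_split lerD.
Qed.

Lemma Lambda_monomial l k a : a \in Lambda_fset R k ->
  word_monomial l a = \prod_(i < n) l 0 i ^+ k i.
Proof. by rewrite in_Lambda_fset word_monomialE => /asboolP ->. Qed.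

(** The monomial is common to all words of [Lambda k] and factors out; what is left is [omega mu k],
    cancelled by the normalisation of y^(k). *)
Lemma inner_sym_eval k l (ld : convergence_domain mu l) :
  inner (sym_vector mu k) (eval_vector ld) = \prod_(i < n) l 0 i ^+ k i.
Proof.
set p := \prod_(i < n) _; rewrite inner_conj inner_sym_vector.
have -> : \sum_(a <- Lambda_fset R k) (wprod mu a)^-1%:C * eval_vector ld a =
    p^* * (omega mu k)%:C.
  rewrite -sum_omega mulr_sumr big_seq [RHS]big_seq; apply: eq_bigr => a ak.
  by rewrite /= (Lambda_monomial _ ak) mulrCA.
rewrite mulrCA -rmorphM/= mulVf ?gt_eqF ?omega_gt0// mulr1.
exact: conjCK.
Qed.

Definition scale_letter (j : 'I_n) (t : R) l : 'rV[R[i]]_n :=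
  \row_i (if i == j then t%:C * l 0 i else l 0 i).

Lemma eval_term_scale_letter (u : fock R n) j (t : R) l a :
  eval_term u (scale_letter j t l) a = (t ^+ letter_count a j)%:C * eval_term u l a.
Proof.
rewrite /eval_term !word_monomialE (bigD1 j)//= [in RHS](bigD1 j)//= !mxE eqxx.
rewrite exprMn -rmorphXn/= (eq_bigr (fun i => l 0 i ^+ letter_count a i)).
  by ring.
by move=> i /negPf ij; rewrite mxE ij.
Qed.

(* Powers of the letters are peeled off one at a time, so that only the
   identity theorem in one variable is needed. *)
Lemma eval_vectors_separate (u : fock R n) (r : R) : 0 < r ->
  (forall l, (forall i, `|l 0 i| < r%:C) -> convergence_domain mu l) ->
  (forall l (ld : convergence_domain mu l), inner u (eval_vector ld) = 0) ->
  forall k, inner u (sym_vector mu k) = 0.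
Proof.
move=> r0 rD u0 k.
have peel (s : seq 'I_n) l : (forall i, `|l 0 i| < r%:C) ->
    summability.sum (fun a =>
      (all (fun i => letter_count a i == k i) s)%:R * eval_term u l a) = 0.
  elim: s l => [|j s IH] l lr.
    rewrite -(u0 l (rD l lr)) inner_eval_vector.
    by congr summability.sum; apply/funext => a; rewrite mul1r.
  have [M uM] := abs_bounded_eval_term u (rD l lr).
  pose c a := (all (fun i => letter_count a i == k i) s)%:R * eval_term u l a.
  have cM : abs_bounded c M.
    apply: abs_bounded_le uM _ => a; rewrite /c; case: all; rewrite ?mul1r//.
    by rewrite mul0r Normc.normc0 normc_ge0.
  have := fiber_sum_eq0 (c := c) (d := fun a => letter_count a j) cM.
  move=> /(_ _ (k j)) <-.
    congr summability.sum; apply/funext => a /=.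
    by rewrite /c mulrA -natrM mulnb.
  move=> t t0 t1; rewrite -(IH (scale_letter j t l)) => [|i].
    congr summability.sum; apply/funext => a.
    by rewrite eval_term_scale_letter mulrCA.
  rewrite mxE; case: eqP => // _; apply: le_lt_trans (lr i).
  rewrite normrM ger0_norm ?lecR ?(ltW t0)//.
  by rewrite ler_piMl// lecR.
(* All coordinates are nonzero, so the common monomial of the words in [Lambda k] can be divided
   out. *)
pose l : 'rV[R[i]]_n := const_mx (r / 2)%:C.
have lr i : `|l 0 i| < r%:C.
  rewrite mxE ger0_norm ?lecR ?divr_ge0 ?(ltW r0)// ltcR.
  by rewrite ltr_pdivrMr// ltr_pMr// ltr1n.
have l0 i : l 0 i != 0.
  by rewrite mxE (inj_eq (@complexI R)) mulf_neq0 ?invr_eq0 ?pnatr_eq0 ?gt_eqF.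
set p := \prod_(i < n) l 0 i ^+ k i.
have p0 : p != 0 by apply/prodf_neq0 => i _; rewrite expf_neq0.
have := peel (enum 'I_n) l lr.
rewrite (@sum_finite_support _ _ _ (Lambda_fset R k)) => [S0|a ak]; last first.
  case: allP => [h|]; rewrite ?mul0r//; move: ak; rewrite in_Lambda_fset.
  case: asboolP => // -[]; apply/funext => i; apply/eqP/h.
  by rewrite mem_enum.
rewrite inner_sym_vector; apply/eqP; rewrite mulf_eq0; apply/orP; right.
rewrite -(mulrI_eq0 _ (lregP p0)) -[X in _ == X]S0 mulr_sumr; apply/eqP.
rewrite big_seq [RHS]big_seq; apply: eq_bigr => a ak.
have -> : all (fun i => letter_count a i == k i) (enum 'I_n).
  by apply/allP => i _; move: ak; rewrite in_Lambda_fset => /asboolP ->.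
by rewrite mul1r /eval_term (Lambda_monomial _ ak) -/p; ring.
Qed.

End point_evaluations.

(** * The compressed shifts on the symmetric Fock space, and the conclusion *)

Section compressed_shifts.
Variables (R : realType) (n : nat) (mu : weight_sequence R n).
Implicit Types (k m : 'I_n -> nat) (i : 'I_n).

Lemma sym_basis_subproof k : sym_vector mu k \in csub_pred (sym_fock mu).
Proof. by apply/asboolP => M [_ MS]; apply: MS; exists k. Qed.

Definition sym_basis k : csub (sym_fock mu) := CSub (sym_basis_subproof k).

Lemma sym_fock_orthogonal (w : fock R n) :
  (forall k, inner w (sym_vector mu k) = 0) ->
  forall x : csub (sym_fock mu), inner w (csub_val x) = 0.
Proof.
move=> w0 x; rewrite inner_conj; apply/eqP; rewrite conjC_eq0; apply/eqP.
have /asboolP xM := valP x.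
apply: (xM [set z | inner z w = 0]); split; first exact: inner_kernel_closed_subspace.
by move=> _ [k _ <-] /=; rewrite inner_conj w0 rmorph0.
Qed.

Lemma sym_basis_total (M : set (csub (sym_fock mu))) : closed_subspace M ->
  (forall k, M (sym_basis k)) -> forall x, M x.
Proof.
move=> Mcl Mb; apply: (closed_subspace_total (S := range sym_basis)) => // [x x0|].
  have xk k : inner (csub_val x) (sym_vector mu k) = 0 by apply: (x0 (sym_basis k)); exists k.
  by apply/eqP; rewrite -innerxx_eq0; apply/eqP; exact: (sym_fock_orthogonal xk).
by move=> _ [k _ <-].
Qed.

Lemma inner_sym_basis k m : inner (sym_basis k) (sym_basis m) =
  if `[< k = m >] then (omega mu m)^-1%:C else 0.
Proof. exact: inner_sym_vectors. Qed.

Lemma compressed_shift_basis i k :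
  compressed_shift mu i (sym_basis k) = sym_basis (addk (unitk i) k).
Proof.
apply: orth_proj_unique; apply: sym_fock_orthogonal => m.
by rewrite innerBl inner_left_shift_sym_vector subrr.
Qed.

Lemma bounded_compressed_shift i : bounded_operator (compressed_shift mu i).
Proof.
split.
  by move=> c x z; rewrite /compressed_shift linear_left_shift linear_orth_proj.
have [K _ WK] := bounded_left_shift mu i; exists K => x.
apply: le_trans (norm_orth_proj _ _) _; rewrite csub_normE; exact: WK.
Qed.

End compressed_shifts.

Theorem theorem6p4 (R : realType) (n : nat) (n_gt0 : (0 < n)%N)
    (mu : weight_sequence R n)
    (mu_domain : nbhs (0 : 'rV[R[i]]_n) (convergence_domain mu)) :
  reflexive_algebra (sym_hardy_algebra mu).
Proof.
have /nbhs_ballP[_ /gt0_complexP[r r0 ->] rD] := mu_domain.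
have rD' (l : 'rV[R[i]]_n) : (forall i, `|l 0 i| < r%:C) -> convergence_domain mu l.
  (* A ball of row vectors is a polydisc, its distance being taken entrywise. *)
  move=> lr; apply: rD; split=> [|i j]; first by rewrite ltcR.
  rewrite (ord1 i) -ball_normE /= mxE sub0r normrN.
  exact: lr.
(* Projecting places the evaluation vectors in the subspace type without a membership proof, and
   leaves their inner products with symmetric vectors unchanged. *)
pose V := [set v | exists l, exists ld : convergence_domain mu l,
  v = orth_proj (sym_fock mu) (eval_vector ld)].
have VE v : V v -> exists2 l, convergence_domain mu l &
    forall k, inner (sym_basis mu k) v = \prod_(i < n) l 0 i ^+ k i.
  move=> [l [ld ->]]; exists l => // k; rewrite inner_conj inner_orth_proj.
  by rewrite -inner_conj; exact: inner_sym_eval.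
apply: (orthogonal_shift_algebra_reflexive (y := sym_basis mu) (V := V)).
- by move=> k m km; rewrite inner_sym_basis; case: asboolP.
- move=> k; rewrite -innerxx_eq0 inner_sym_basis; case: asboolP => // _.
  by rewrite (inj_eq (@complexI R)) invr_eq0 gt_eqF// omega_gt0.
- exact: sym_basis_total.
- exact: bounded_compressed_shift.
- exact: compressed_shift_basis.
- by move=> v /VE[l _ ->]; rewrite big1.
- move=> v i /VE[l _ vE]; exists (l 0 i) => k; rewrite !vE.
  rewrite (bigD1 i)//= [in RHS](bigD1 i)//= mulrA /addk /unitk eqxx exprS.
  by congr (_ * _); apply: eq_bigr => j /negPf ->.
move=> u u0; apply/eqP; rewrite -innerxx_eq0; apply/eqP.
apply: sym_fock_orthogonal => k.
apply: (eval_vectors_separate r0 rD') => l ld.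
have /u0 : V (orth_proj (sym_fock mu) (eval_vector ld)) by exists l, ld.
rewrite inner_conj inner_orth_proj => h.
by rewrite inner_conj.
Qed.
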